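(* For every integer $n\geq 2$, $$\min_{0\leq r\leq 4n-2}\left\{\binom{\lfloor (4n-1-r)/3\rfloor}{n}+r(4n-5)\right\}\leq \operatorname{GM}_3(K_{1,3}:nK_2)\leq (2n-1)!!,$$ where the minimum is over integers $r$.
   Context: All graphs are finite, simple and undirected; colorings are edge-colorings. $K_{1,3}$ is the star with three edges; $nK_2$ is a matching with $n$ edges. A $k$-coloring is exact if all $k$ colors are used at least once. A colored graph is rainbow if no two of its edges have the same color, and monochromatic if all its edges have the same color. Copies of a graph are counted as (not necessarily induced) subgraphs. $\binom{a}{b}=0$ if $0\le a<b$, and $(2n-1)!!=(2n-1)(2n-3)\cdots 3\cdot 1$. The Gallai-Ramsey number $\operatorname{gr}_k(G:H)$ is the minimum integer $m$ with $\binom{m}{2}\geq k$ such that for every $N\geq m$, every exact $k$-coloring of $K_N$ contains a rainbow copy of $G$ or a monochromatic copy of $H$. The Gallai-Ramsey multiplicity $\operatorname{GM}_k(G:H)$ (also written $\operatorname{GM}_k(G,H)$) is the minimum, over all exact $k$-colorings of $K_{\operatorname{gr}_k(G:H)}$, of the total number of rainbow copies of $G$ and monochromatic copies of $H$. *)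

(* Defs.v *)
From mathcomp Require Import all_boot.

Set Implicit Arguments.
Unset Strict Implicit.
Unset Printing Implicit Defensive.

Record sgraph := SGraph {
  vertex :> finType;
  adj : rel vertex;
  adj_sym : symmetric adj;
  adj_irrefl : irreflexive adj }.

Definition edges (G : sgraph) : {set {set G}} :=
  [set [set x; y] | x in G, y in G & adj x y].

Definition complete_adj (N : nat) : rel 'I_N := fun x y => x != y.

Lemma complete_sym (N : nat) : symmetric (@complete_adj N).
Proof. by move=> x y; rewrite /complete_adj eq_sym. Qed.

Lemma complete_irrefl (N : nat) : irreflexive (@complete_adj N).
Proof. by move=> x; rewrite /complete_adj eqxx. Qed.

Definition complete (N : nat) : sgraph :=
  SGraph (@complete_sym N) (@complete_irrefl N).

(* The centre of K_{1,3} is 0; two vertices are adjacent when exactly one of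
   them is the centre. *)
Definition star3_adj : rel 'I_4 := fun x y => (x == ord0) (+) (y == ord0).

Lemma star3_sym : symmetric star3_adj.
Proof. by move=> x y; rewrite /star3_adj addbC. Qed.

Lemma star3_irrefl : irreflexive star3_adj.
Proof. by move=> x; rewrite /star3_adj addbb. Qed.

Definition star3 : sgraph := SGraph star3_sym star3_irrefl.

(* The n edges of nK_2 join (i, false) to (i, true). *)
Definition matching_adj (n : nat) : rel ('I_n * bool) :=
  fun x y => (x.1 == y.1) && (x.2 != y.2).

Lemma matching_sym (n : nat) : symmetric (@matching_adj n).
Proof.
by move=> x y; rewrite /matching_adj eq_sym; congr (_ && ~~ _); rewrite eq_sym.
Qed.

Lemma matching_irrefl (n : nat) : irreflexive (@matching_adj n).
Proof. by move=> x; rewrite /matching_adj !eqxx. Qed.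

Definition matching (n : nat) : sgraph :=
  SGraph (@matching_sym n) (@matching_irrefl n).

(* A copy is a subgraph, i.e. a pair (vertex set, edge set), so that distinct
   embeddings with the same image are counted once. *)
Definition copies (G F : sgraph) : {set {set F} * {set {set F}}} :=
  [set S | [exists f : {ffun G -> F},
    [&& injectiveb f,
        S.1 == f @: [set: G],
        S.2 == [set f @: (e : {set G}) | e in edges G]
      & S.2 \subset edges F]]].

(* A coloring is defined on all vertex sets, but only its values on edges are
   ever used; a minimum over colorings is not affected by the other values. *)
Definition coloring (k N : nat) : Type :=
  {ffun {set complete N} -> 'I_k}.

Definition exact (k N : nat) (c : coloring k N) : Prop :=
  forall i : 'I_k, exists2 e, e \in edges (complete N) & c e = i.

Definition rainbow (k N : nat) (c : coloring k N)
    (E : {set {set complete N}}) : bool :=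
  [forall e in E, forall f in E, (c e == c f) ==> (e == f)].

Definition monochromatic (k N : nat) (c : coloring k N)
    (E : {set {set complete N}}) : bool :=
  [forall e in E, forall f in E, c e == c f].

Definition rainbow_copies (k N : nat) (c : coloring k N) (G : sgraph) :=
  [set S in copies G (complete N) | rainbow c S.2].

Definition mono_copies (k N : nat) (c : coloring k N) (H : sgraph) :=
  [set S in copies H (complete N) | monochromatic c S.2].

Definition is_minimum (P : nat -> Prop) (m : nat) : Prop :=
  P m /\ forall m', P m' -> m <= m'.

Definition gr_bound (k : nat) (G H : sgraph) (m : nat) : Prop :=
  k <= 'C(m, 2) /\
  forall N, m <= N -> forall c : coloring k N, exact c ->
    (exists S, S \in rainbow_copies c G) \/ (exists S, S \in mono_copies c H).

(* m = gr_k(G : H); at most one m satisfies this. *)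
Definition is_gr (k : nat) (G H : sgraph) (m : nat) : Prop :=
  is_minimum (gr_bound k G H) m.

(* g = GM_k(G : H); at most one g satisfies this, and none does unless
   gr_k(G : H) exists. *)
Definition is_GM (k : nat) (G H : sgraph) (g : nat) : Prop :=
  exists2 m, is_gr k G H m &
    is_minimum (fun t => exists2 c : coloring k m, exact c &
      t = #|rainbow_copies c G| + #|mono_copies c H|) g.

(* (2n-1)!! *)
Definition odd_double_fact (n : nat) : nat := \prod_(i < n) (2 * i + 1).

(* All the natural-number subtractions are exact when 2 <= n and
   r <= 4n - 2. *)
Definition lower_term (n r : nat) : nat :=
  'C((4 * n - 1 - r) %/ 3, n) + r * (4 * n - 5).

(* The neutral element is the term for r = 0, which belongs to the range, so
   that this is the minimum of the terms for 0 <= r <= 4n - 2. *)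
Definition lower_bound (n : nat) : nat :=
  \big[minn/lower_term n 0]_(0 <= r < (4 * n - 2).+1) lower_term n r.

(* Main.v *)
(* A vertex seeing all three colors, with color degrees d1, d2, d3, is the centre
   of d1 d2 d3 rainbow stars, so few rainbow stars means few such trichromatic
   vertices, most of their edges having the same color. The vertices avoiding a given
   color form a class whose edges carry only the two other colors; everything
   happens around a largest such class A.

   If v in A has edges vx and vy of the two colors, a monochromatic
   (m-1)-matching of the coloring without v, x, y extends by vx or by vy.
   Starting from 3m-1 vertices this yields a monochromatic m-matching, whence
   gr = 3n-1; and if v has at least t edges of each color, averaging over the
   triples multiplies the number of matchings by t. When no vertex of A has m
   edges of each color, either m vertices of A have almost only edges of one
   color, or m vertices outside A send mostly the same color to A (both give
   many matchings at once), or double counting contradicts the small number of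
   rainbow stars. The argument breaks down only if A has at most n vertices while
   at least n-3 vertices are trichromatic; then two thirds of n vertices have all
   edges but two in one common color, and that color has many n-matchings.

   With N = 3n-1 vertices the summand r(4n-5) of the lower bound exceeds what r
   trichromatic vertices cost; for n >= 7 only its value at r = n-6, which is
   4n^2-28n+31, is used. *)
Require Import Defs.
From mathcomp Require Import all_boot.
From mathcomp Require Import zify.

Set Implicit Arguments.
Unset Strict Implicit.
Unset Printing Implicit Defensive.

(* [lia] preprocesses the whole context; here only the arithmetic part of it is kept. *)
Ltac arith :=
  repeat match goal with
  | H : is_true (leq _ _) |- _ => revert H
  | H : @eq nat _ _ |- _ => revert H
  end; clear; intros; lia.

(** * Matchings in a graph with two colors *)

Section Matchings.

Variables (V : finType) (A : {set V}) (g : rel V).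
Hypothesis gsym : symmetric g.

Implicit Types (b : bool) (W X Y K H : {set V}) (M : {set {set V}}) (e : {set V}) (v x y : V) (m k : nat).

(* Only the edges that meet [A] count: in the application all of these have one of
   two colors, the first one being marked by [g], whereas the edges outside [A] may
   have a third color. *)
Definition medge (b : bool) (e : {set V}) : bool :=
  [exists x, exists y, [&& x \in A, x != y, g x y == b & e == [set x; y]]].

Definition matchings (b : bool) (W : {set V}) (m : nat) : {set {set {set V}}} :=
  [set M : {set {set V}} | [&& #|M| == m, trivIset M, cover M \subset W
             & [forall e in M, medge b e]]].

Lemma medgeP b x y : x != y -> g x y = b -> (x \in A) || (y \in A) ->
  medge b [set x; y].
Proof.
move=> nxy gxy /orP[xA|yA]; apply/existsP.
  by exists x; apply/existsP; exists y; rewrite xA nxy gxy !eqxx.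
by exists y; apply/existsP; exists x; rewrite yA eq_sym nxy gsym gxy setUC !eqxx.
Qed.

Lemma matchingsP b W m M : reflect
  [/\ #|M| = m, trivIset M, (forall e, e \in M -> e \subset W)
    & forall e, e \in M -> medge b e] (M \in matchings b W m).
Proof.
rewrite inE; apply: (iffP and4P) => [[/eqP ? ? cW /forall_inP ?]|[? ? cW ?]].
  by split=> // e eM; apply: subset_trans cW; apply: bigcup_sup eM.
split=> //; [exact/eqP| |exact/forall_inP].
by apply/bigcupsP.
Qed.

Lemma matchings0 b W : set0 \in matchings b W 0.
Proof.
apply/matchingsP; split=> [|||]; rewrite ?cards0 //.
- by apply/trivIsetP=> e f; rewrite inE.
- by move=> e; rewrite inE.
- by move=> e; rewrite inE.
Qed.

Lemma medge_neq0 b e : medge b e -> e != set0.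
Proof.
case/existsP=> x /existsP[y /and4P[_ _ _ /eqP->]].
by apply/set0Pn; exists x; rewrite !inE eqxx.
Qed.

Lemma matchings_mono b (W W' : {set V}) m :
  W \subset W' -> matchings b W m \subset matchings b W' m.
Proof.
move=> sW; apply/subsetP=> M /matchingsP[? ? cW ?]; apply/matchingsP; split=> // e eM.
exact: subset_trans (cW e eM) sW.
Qed.

Lemma matchingsU b (W1 W2 : {set V}) m1 m2 M1 M2 : [disjoint W1 & W2] ->
  M1 \in matchings b W1 m1 -> M2 \in matchings b W2 m2 ->
  M1 :|: M2 \in matchings b (W1 :|: W2) (m1 + m2) /\ [disjoint M1 & M2].
Proof.
move=> dW /matchingsP[c1 t1 s1 e1] /matchingsP[c2 t2 s2 e2].
have d12 e f : e \in M1 -> f \in M2 -> [disjoint e & f].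
  move=> eM fM; apply: disjointWl (s1 _ eM) _; apply: disjointWr (s2 _ fM) dW.
have dM : [disjoint M1 & M2].
  rewrite disjoints_subset; apply/subsetP=> e eM; rewrite inE; apply/negP=> eM2.
  have := d12 _ _ eM eM2; rewrite -setI_eq0 setIid.
  by rewrite (negbTE (medge_neq0 (e1 _ eM))).
split=> //; apply/matchingsP; split.
- by rewrite cardsU (disjoint_setI0 dM) cards0 subn0 c1 c2.
- apply/trivIsetP=> e f; rewrite !inE => /orP[eM|eM] /orP[fM|fM] nef.
  + exact: (trivIsetP t1).
  + exact: d12.
  + by rewrite disjoint_sym; apply: d12.
  + exact: (trivIsetP t2).
- move=> e; rewrite inE => /orP[/s1|/s2] /subset_trans; apply; last exact: subsetUr.
  exact: subsetUl.
- by move=> e; rewrite inE => /orP[/e1|/e2].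
Qed.

Lemma matchings_edge b x y : x != y -> g x y = b -> (x \in A) || (y \in A) ->
  [set [set x; y]] \in matchings b [set x; y] 1.
Proof.
move=> nxy gxy xyA; apply/matchingsP; split.
- by rewrite cards1.
- by apply/trivIsetP=> e f; rewrite !inE => /eqP-> /eqP->; rewrite eqxx.
- by move=> e; rewrite inE => /eqP->.
- by move=> e; rewrite inE => /eqP->; apply: medgeP.
Qed.

(** The union of two matchings can be split again: edges are nonempty, so those of the first part
    meet [W1], whereas those of the second part are disjoint from it. *)
Lemma matchings_prod b (W1 W2 : {set V}) m1 m2 : [disjoint W1 & W2] ->
  #|matchings b W1 m1| * #|matchings b W2 m2| <= #|matchings b (W1 :|: W2) (m1 + m2)|.
Proof.
move=> dW; rewrite -cardsX.
pose f (p : {set {set V}} * {set {set V}}) := p.1 :|: p.2.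
rewrite -(card_in_imset (f := f)); last first.
  move=> [M1 M2] [N1 N2] /setXP[/= m1' m2'] /setXP[/= n1 n2] /= eqf.
  have sep (M N : {set {set V}}) e : M \in matchings b W1 m1 -> N \in matchings b W2 m2 ->
      (e \in M -> ~~ [disjoint e & W1]) /\ (e \in N -> [disjoint e & W1]).
    move=> /matchingsP[_ _ s1 e1] /matchingsP[_ _ s2 _]; split=> eM.
      rewrite -setI_eq0 (setIidPl (s1 _ eM)).
      exact: medge_neq0 (e1 _ eM).
    by rewrite disjoint_sym; apply: disjointWr (s2 _ eM) dW.
  congr pair; apply/setP=> e.
    have [h1 h2] := sep _ _ e m1' m2'; have [h3 h4] := sep _ _ e n1 n2.
    have := congr1 (fun X : {set _} => e \in X) eqf; rewrite /f /= !inE.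
    case: (e \in M1) h1 => [/(_ isT) h1|_]; case: (e \in N1) h3 => [/(_ isT) h3|_] //=.
      by move=> /esym /h4; rewrite (negbTE h1).
    by move=> /h2; rewrite (negbTE h3).
  have [h1 h2] := sep _ _ e m1' m2'; have [h3 h4] := sep _ _ e n1 n2.
  have := congr1 (fun X : {set _} => e \in X) eqf; rewrite /f /= !inE.
  case: (e \in M2) h2 => [/(_ isT) h2|_]; case: (e \in N2) h4 => [/(_ isT) h4|_] //=;
    rewrite ?orbT ?orbF.
    by move=> /esym /h3; rewrite h2.
  by move=> /h1; rewrite h4.
apply: subset_leq_card; apply/subsetP=> _ /imsetP[[M1 M2] /setXP[/= h1 h2] ->].
by have [] := matchingsU dW h1 h2.
Qed.

(** Adding the edge [vx] extends every matching that avoids [v] and [x]. Since a matching has only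
    one edge at [v], different [x] give different matchings, and the counts add up. *)
Lemma matchings_pairstep b (W : {set V}) m v (X : {set V}) :
  v \in W -> X \subset W -> v \notin X ->
  (forall x, x \in X -> g v x = b /\ (v \in A) || (x \in A)) ->
  \sum_(x in X) #|matchings b (W :\ v :\ x) m| <= #|matchings b W m.+1|.
Proof.
move=> vW sXW vX gX.
pose E x := [set M in matchings b W m.+1 | [set v; x] \in M].
apply: (@leq_trans (\sum_(x in X) #|E x|)).
  apply: leq_sum => x xX; have [gvx vxA] := gX x xX.
  have nvx : v != x by apply: contraNneq vX => ->.
  have dW : [disjoint [set v; x] & W :\ v :\ x].
    rewrite -setI_eq0; apply/eqP/setP=> y; rewrite !inE.
    by case: (y == v); case: (y == x); rewrite ?andbF.
  have eW : [set v; x] :|: (W :\ v :\ x) = W.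
    apply/setP=> y; rewrite !inE; have [->|] := eqVneq y v; first by rewrite vW.
    by have [->|] := eqVneq y x; first by rewrite (subsetP sXW).
  rewrite -(card_in_imset (f := fun M => [set [set v; x]] :|: M)).
    apply: subset_leq_card; apply/subsetP=> _ /imsetP[M hM ->].
    have [] := matchingsU dW (matchings_edge nvx gvx vxA) hM; rewrite eW add1n => h _.
    by rewrite inE h !inE eqxx.
  have nin M : M \in matchings b (W :\ v :\ x) m -> [set v; x] \notin M.
    by move=> /(matchingsU dW (matchings_edge nvx gvx vxA))[_]; rewrite disjoints1.
  move=> M N hM hN /= eqMN; apply/setP=> e.
  have [->|ne] := eqVneq e [set v; x]; first by rewrite !(negbTE (nin _ _)).
  by have := congr1 (fun X : {set _} => e \in X) eqMN; rewrite !inE (negbTE ne).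
under eq_bigr => x _ do rewrite -sum1dep_card.
rewrite (exchange_big_dep (fun M => M \in matchings b W m.+1)) /=; last first.
  by move=> x M _ /andP[].
rewrite -sum1_card; apply: leq_sum => M hM; rewrite sum1dep_card.
apply/card_le1_eqP=> x y; rewrite !inE => /and3P[xX _ xM] /and3P[yX _ yM].
have /matchingsP[_ tM _ _] := hM.
apply/eqP; apply: contraT => nxy.
have: [disjoint [set v; x] & [set v; y]].
  apply: (trivIsetP tM) => //; apply/eqP=> /setP/(_ x); rewrite !inE eqxx orbT.
  rewrite [x == y]eq_sym (negbTE nxy) orbF => /esym/eqP exv.
  by rewrite -exv xX in vX.
by rewrite -setI_eq0 => /eqP/setP/(_ v); rewrite !inE eqxx.
Qed.


Lemma matchings_pairstep_gt0 b W m v x :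
  v \in W -> x \in W -> v != x -> g v x = b -> (v \in A) || (x \in A) ->
  0 < #|matchings b (W :\ v :\ x) m| -> 0 < #|matchings b W m.+1|.
Proof.
move=> vW xW nvx gvx vxA h; apply: leq_trans h _.
have := @matchings_pairstep b W m v [set x] vW; rewrite big_set1 sub1set inE.
by apply=> // y; rewrite inE => /eqP->.
Qed.

Definition num_matchings W m : nat := #|matchings true W m| + #|matchings false W m|.

Lemma num_matchings_bool b W m :
  num_matchings W m = #|matchings b W m| + #|matchings (~~ b) W m|.
Proof. by case: b; rewrite // addnC. Qed.

Lemma leq_matchings_num b W m : #|matchings b W m| <= num_matchings W m.
Proof. by rewrite (num_matchings_bool b) leq_addr. Qed.

(* Every matching that avoids v, x, y extends by vx or by vy, according to its color;
   a given matching arises in this way from at most #|Y| (or #|X|) pairs (x, y),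
   because it has only one edge at v. *)
Lemma num_matchings_tristep W m v X Y t F :
  v \in W -> X \subset W -> Y \subset W -> v \notin X -> v \notin Y ->
  (forall x, x \in X -> g v x = true /\ (v \in A) || (x \in A)) ->
  (forall y, y \in Y -> g v y = false /\ (v \in A) || (y \in A)) ->
  t <= #|X| -> t <= #|Y| ->
  (forall x y, x \in X -> y \in Y -> F <= num_matchings (W :\ v :\ x :\ y) m) ->
  t * F <= num_matchings W m.+1.
Proof.
move=> vW sX sY vX vY gX gY tX tY hF.
have hX := matchings_pairstep m vW sX vX gX.
have hY := matchings_pairstep m vW sY vY gY.
have h : #|X| * #|Y| * F <= #|Y| * #|matchings true W m.+1| + #|X| * #|matchings false W m.+1|.
  apply: (@leq_trans (\sum_(x in X) \sum_(y in Y) num_matchings (W :\ v :\ x :\ y) m)).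
    rewrite -mulnA -!sum_nat_const; apply: leq_sum => x xX.
    by apply: leq_sum => y yY; apply: hF.
  rewrite /num_matchings; under eq_bigr => x _ do rewrite big_split /=.
  rewrite big_split /=; apply: leq_add.
    rewrite exchange_big /= -sum_nat_const; apply: leq_sum => y _.
    apply: leq_trans hX; apply: leq_sum => x _; apply: subset_leq_card.
    exact: matchings_mono (subsetDl _ _).
  rewrite -sum_nat_const; apply: leq_sum => x _.
  apply: leq_trans hY; apply: leq_sum => y _; apply: subset_leq_card.
  by apply: matchings_mono; rewrite setDDl setUC -setDDl subsetDl.
(* In [h] the smaller of the two weights is raised to the larger one, by which both sides are then
   divided. *)
rewrite /num_matchings; case: (posnP t) => [->//|t0]; case: (leqP #|X| #|Y|) => hXY.
  apply: (@leq_trans (#|X| * F)); first by rewrite leq_mul2r tX orbT.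
  rewrite -(leq_pmul2l (leq_trans t0 tY)); apply: (@leq_trans (#|X| * #|Y| * F)); first lia.
  by apply: leq_trans h _; rewrite mulnDr leq_add2l leq_mul2r hXY orbT.
apply: (@leq_trans (#|Y| * F)); first by rewrite leq_mul2r tY orbT.
rewrite -(leq_pmul2l (leq_trans t0 tX)); apply: (@leq_trans (#|X| * #|Y| * F)); first lia.
by apply: leq_trans h _; rewrite mulnDr leq_add2r leq_mul2r (ltnW hXY) orbT.
Qed.

(** The condition on [A] makes both [vx] and [vy] edges that count, whichever of them is needed. *)
Lemma num_matchings_tristep_gt0 W m v x y :
  v \in W -> x \in W -> y \in W -> v != x -> v != y ->
  g v x != g v y -> (v \in A) || (x \in A) && (y \in A) ->
  0 < num_matchings (W :\ v :\ x :\ y) m -> 0 < num_matchings W m.+1.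
Proof.
wlog gx : x y / g v x = true => [hw|].
  move=> vW xW yW nx ny gxy hA h.
  case: (boolP (g v x)) => gx; first exact: (hw x y).
  apply: (hw y x) => //.
  - by move: gxy; rewrite (negbTE gx); case: (g v y).
  - by rewrite eq_sym.
  - by rewrite andbC.
  - by rewrite setDDl setUC -setDDl.
move=> vW xW yW nx ny; rewrite gx => gy hA h.
have {}gy : g v y = false by case: (g v y) gy.
rewrite -[X in X < _](mul1n 0).
have := @num_matchings_tristep W m v [set x] [set y] 1 1 vW; rewrite !sub1set !inE !cards1 muln1.
apply=> //.
- by move=> z; rewrite inE => /eqP->; split=> //; case: (v \in A) hA => //= /andP[->].
- by move=> z; rewrite inE => /eqP->; split=> //; case: (v \in A) hA => //= /andP[_ ->].
- by move=> x' y'; rewrite !inE => /eqP-> /eqP->.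
Qed.

(** The vertices of [H] get partners in [K] one after the other. Each choice takes at most one
    partner away from every remaining vertex, so the numbers of choices are at least D, D - 1, and
    so on. *)
Lemma matchings_many b W H K D m :
  H \subset W -> K \subset W -> [disjoint H & K] -> m <= #|H| ->
  (forall h, h \in H -> D <= #|[set k in K | g h k == b]|) ->
  (forall h (k : V), h \in H -> k \in K -> (h \in A) || (k \in A)) ->
  D ^_ m <= #|matchings b W m|.
Proof.
elim: m W H K D => [|m IHm] W H K D sH sK dHK hm hD hA.
  by rewrite ffactn0 card_gt0; apply/set0Pn; exists set0; apply: matchings0.
have /set0Pn[h hH] : H != set0 by rewrite -card_gt0; apply: leq_trans hm.
have hW := subsetP sH _ hH.
pose X := [set k in K | g h k == b].
have XW x : x \in X -> [/\ x \in W, x \in K & g h x = b].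
  by rewrite inE => /andP[xK /eqP gx]; split=> //; apply: (subsetP sK).
have sepHK y z : y \in H -> z \in K -> y != z.
  by move=> yH zK; apply: contraTneq zK => <-; rewrite (disjointFr dHK yH).
have := @matchings_pairstep b W m h X hW.
rewrite ffactnS => step; apply: leq_trans (step _ _ _); last first.
- by move=> x /XW[_ xK gx]; split=> //; apply: hA.
- by rewrite inE (disjointFr dHK hH).
- by apply/subsetP=> x /XW[].
apply: (@leq_trans (\sum_(x in X) D.-1 ^_ m)).
  by rewrite sum_nat_const leq_mul2r hD ?orbT.
apply: leq_sum => x /XW[xW xK gx].
apply: (IHm _ (H :\ h) (K :\ x)).
- apply/subsetP=> y; rewrite !inE => /andP[-> yH] /=.
  by rewrite (sepHK y x) // (subsetP sH).
- apply/subsetP=> y; rewrite !inE => /andP[-> yK] /=.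
  by rewrite eq_sym (sepHK h y) // (subsetP sK).
- by apply: disjointWl (subsetDl _ _) _; apply: disjointWr (subsetDl _ _) _.
- by have := cardsD1 h H; rewrite hH => cH; move: hm; rewrite cH; move: #|_| => c; clear; lia.
- move=> y; rewrite inE => /andP[_ yH].
  have := hD y yH; rewrite (cardsD1 x) inE xK /=.
  have -> : [set k in K :\ x | g y k == b] = [set k in K | g y k == b] :\ x.
    by apply/setP=> z; rewrite !inE andbA.
  by case: (g y x == b) => /=; rewrite ?add0n ?add1n; move: #|_| => c; clear; lia.
- by move=> y z; rewrite !inE => /andP[_ yH] /andP[_ zK]; apply: hA.
Qed.

(** When the [j]-th vertex of [hs] is treated, [j] vertices of [K] are occupied and at most [w] are
    joined to it in the wrong color, so a partner is left. *)
Lemma matchings_greedy b W K (hs : seq V) (w : V -> nat) (v0 : V) :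
  uniq hs -> {subset hs <= W} -> K \subset W -> K \subset A ->
  (forall h, h \in hs -> h \notin K) ->
  (forall h, h \in hs -> #|[set k in K | g h k != b]| <= w h) ->
  (forall j, j < size hs -> w (nth v0 hs j) + j < #|K|) ->
  0 < #|matchings b W (size hs)|.
Proof.
elim: hs W K => [|h hs IHhs] W K /=.
  by move=> *; rewrite card_gt0; apply/set0Pn; exists set0; apply: matchings0.
case/andP=> hhs uhs sW sK sA nK hw hj.
have hW : h \in W by apply: sW; rewrite inE eqxx.
have h0 := hw h (mem_head _ _); have j0 := hj 0 isT; rewrite /= addn0 in j0.
have hhK : h \notin K by apply: nK; rewrite inE eqxx.
have /set0Pn[k] : [set k in K | g h k == b] != set0.
  rewrite -card_gt0; have := cardsID [set k | g h k == b] K.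
  have -> : K :&: [set k | g h k == b] = [set k in K | g h k == b].
    by apply/setP=> z; rewrite !inE.
  have -> : K :\: [set k | g h k == b] = [set k in K | g h k != b].
    by apply/setP=> z; rewrite !inE andbC.
  lia.
rewrite inE => /andP[kK /eqP gk]; have kW := subsetP sK _ kK.
apply: (@matchings_pairstep_gt0 b W (size hs) h k) => //.
- by apply: contraNneq hhK => ->.
- by rewrite (subsetP sA _ kK) orbT.
apply: (IHhs _ (K :\ k)) => //.
- move=> y yhs; rewrite !inE sW ?inE ?yhs ?orbT // andbT.
  apply/andP; split; last by apply: contraNneq hhs => <-.
  by apply: contraTneq kK => <-; apply: nK; rewrite inE yhs orbT.
- apply/subsetP=> y; rewrite !inE => /andP[-> yK] /=.
  by rewrite (subsetP sK) // andbT; apply: contraNneq hhK => <-.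
- exact: subset_trans (subsetDl _ _) sA.
- by move=> y yhs; rewrite inE negb_and nK ?orbT // inE yhs orbT.
- move=> y yhs; apply: leq_trans (hw y _); last by rewrite inE yhs orbT.
  apply: subset_leq_card; apply/subsetP=> z; rewrite !inE.
  by case/andP=> /andP[_ ->].
- move=> j lj; have := hj j.+1; rewrite ltnS => /(_ lj) /=.
  by have := cardsD1 k K; rewrite kK => ->; move: (w _) #|_| => c d; clear; lia.
Qed.

End Matchings.

(** * Existence of a monochromatic matching when the class is large *)

Section Existence.

Variables (V : finType) (A : {set V}) (g : rel V).
Hypothesis gsym : symmetric g.

Implicit Types (b : bool) (W X Y K H : {set V}) (M : {set {set V}}) (e : {set V}) (v x y : V) (m k : nat).

Local Notation matchings := (matchings A g).
Local Notation num_matchings := (num_matchings A g).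

Lemma card_tri W v x y : v \in W -> x \in W -> y \in W -> v != x -> v != y -> x != y ->
  #|W :\ v :\ x :\ y| + 3 = #|W|.
Proof.
move=> vW xW yW vx vy xy.
have := cardsD1 v W; have := cardsD1 x (W :\ v); have := cardsD1 y (W :\ v :\ x).
rewrite !in_setD1 vW xW yW [y == v]eq_sym vy [y == x]eq_sym xy [x == v]eq_sym vx /=; arith.
Qed.

Lemma card_triA W v x y : v \in W -> x \in W -> y \in W -> v != x -> v != y -> x != y ->
  #|A :&: (W :\ v :\ x :\ y)| + ((v \in A) + (x \in A) + (y \in A)) = #|A :&: W|.
Proof.
move=> vW xW yW vx vy xy.
have -> : A :&: (W :\ v :\ x :\ y) = (A :&: W) :\ v :\ x :\ y.
  by rewrite !setIDA.
have := cardsD1 v (A :&: W); have := cardsD1 x ((A :&: W) :\ v).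
have := cardsD1 y ((A :&: W) :\ v :\ x).
rewrite !in_setD1 !in_setI vW xW yW [y == v]eq_sym vy [y == x]eq_sym xy [x == v]eq_sym vx /= !andbT; arith.
Qed.

(** If no vertex of [S] sees two colors inside [S], then any two edges [xy] and [uv] have the color
    of the edge [xv] that links them. *)
Lemma mono_or_mixed (S : {set V}) :
  (exists b, forall x y, x \in S -> y \in S -> x != y -> g x y = b) \/
  (exists x y1 y2, [/\ x \in S, y1 \in S & y2 \in S] /\ [/\ x != y1, x != y2 & g x y1 != g x y2]).
Proof.
case: (boolP [exists x, exists y1, exists y2, [&& x \in S, y1 \in S, y2 \in S, x != y1,
    x != y2 & g x y1 != g x y2]]) => [|hN].
  by case/existsP=> x /existsP[y1 /existsP[y2 /and5P[? ? ? ? /andP[? ?]]]]; right; exists x, y1, y2.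
have {}hN x y1 y2 : x \in S -> y1 \in S -> y2 \in S -> x != y1 -> x != y2 -> g x y1 = g x y2.
  move=> xS y1S y2S n1 n2; apply/eqP; apply: contraNT hN => h.
  by apply/existsP; exists x; apply/existsP; exists y1; apply/existsP; exists y2; apply/and5P; rewrite n2.
left; case: (boolP [exists x, exists y, [&& x \in S, y \in S & x != y]]) => [|hN2].
  case/existsP=> x /existsP[y /and3P[xS yS xy]]; exists (g x y) => u v uS vS uv.
  have [euv|nxv] := eqVneq x v.
    by rewrite gsym -euv (hN x y u) // euv eq_sym.
  by rewrite (hN x y v) // gsym (gsym x v) (hN v x u) // eq_sym.
exists true => x y xS yS xy; case/negP: hN2.
by apply/existsP; exists x; apply/existsP; exists y; rewrite xS yS xy.
Qed.

Lemma subset_of_size (W : {set V}) m : m <= #|W| -> exists2 H : {set V}, H \subset W & #|H| = m.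
Proof.
move=> hm; exists [set x in take m (enum W)].
  apply/subsetP=> x; rewrite inE => /mem_take; by rewrite mem_enum.
rewrite cardsE (card_uniqP _) ?take_uniq ?enum_uniq //.
by rewrite size_takel // -cardE.
Qed.

Lemma matchings_clique b W m : m.*2 <= #|A :&: W| ->
  (forall x y, x \in A :&: W -> y \in A :&: W -> x != y -> g x y = b) -> 0 < #|matchings b W m|.
Proof.
move=> hm hS; have [|H sH cH] := @subset_of_size (A :&: W) m; first arith.
have sHA : H \subset A by apply: subset_trans sH (subsetIl _ _).
have cK : #|(A :&: W) :\: H| >= m.
  by have := cardsID H (A :&: W); rewrite (setIidPr sH); arith.
have nHK x y : x \in H -> y \in (A :&: W) :\: H -> x != y.
  by move=> xH; rewrite inE => /andP[nyH _]; apply: contraNneq nyH => <-.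
apply: leq_trans (_ : m ^_ m <= _); first by rewrite ffactnn fact_gt0.
apply: (@matchings_many V A g gsym b W H ((A :&: W) :\: H) m m); rewrite ?cH //.
- exact: subset_trans sH (subsetIr _ _).
- exact: subset_trans (subsetDl _ _) (subsetIr _ _).
- by rewrite disjoints_subset; apply/subsetP=> x xH; rewrite !inE xH.
- move=> h hH; apply: leq_trans cK _; apply: subset_leq_card; apply/subsetP=> k kK.
  rewrite inE kK /=; apply/eqP/hS; [exact: (subsetP sH)|by case/setDP: kK|exact: nHK].
- by move=> h k hH _; rewrite (subsetP sHA).
Qed.

Lemma num_matchings0_gt0 W : 0 < num_matchings W 0.
Proof.
apply: leq_trans (leq_matchings_num A g true W 0); rewrite card_gt0; apply/set0Pn.
by exists set0; apply: matchings0.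
Qed.

(** Induction on [m]: either the class is a monochromatic clique, or one of its vertices sees two
    colors and a triple is removed. The triple may take only two vertices of the class when the
    second hypothesis is tight. *)
Lemma num_matchings_gt0_big W m : 3 * m <= #|W|.+1 -> m.*2 <= #|A :&: W| -> 0 < num_matchings W m.
Proof.
elim: m W => [|m IHm] W hW hA; first exact: num_matchings0_gt0.
case: (mono_or_mixed (A :&: W)) => [[b hb]|].
  by apply: leq_trans (leq_matchings_num A g b W m.+1); apply: matchings_clique.
case=> x [y1 [y2 [[/setIP[xA xW] /setIP[y1A y1W] /setIP[y2A y2W]] [n1 n2 nc]]]].
have ny : y1 != y2 by apply: contraNneq nc => ->.
case: (boolP ((m == 0) || (m.*2 + 3 <= #|A :&: W|))) => hm.
  apply: (@num_matchings_tristep_gt0 V A g gsym W m x y1 y2); rewrite ?xA //; apply: IHm.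
    by have := card_tri xW y1W y2W n1 n2 ny; arith.
  have := card_triA xW y1W y2W n1 n2 ny; rewrite xA y1A y2A.
  by case/orP: hm => [/eqP->|?] //; arith.
(* Now the class has exactly 2m + 2 vertices in [W], while [W] has at least 3m + 2 and m > 0; so
   there is a [z] outside the class. The color of [xz] differs from that of [xy1] or of [xy2], which
   gives a triple with two class vertices. *)
move: hm; rewrite negb_or -ltnNge => /andP[m0 hm].
have /set0Pn[z] : W :\: A != set0.
  by rewrite -card_gt0; have := cardsID A W; rewrite setIC; move: m0; rewrite -lt0n => ?; arith.
case/setDP=> zW zA; have nzA y : y \in A -> z != y by apply: contraTneq => <-.
have step v u1 u2 : v \in W -> u1 \in W -> u2 \in W -> v != u1 -> v != u2 ->
    g v u1 != g v u2 -> (v \in A) || (u1 \in A) && (u2 \in A) ->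
    (v \in A) + (u1 \in A) + (u2 \in A) = 2 -> 0 < num_matchings W m.+1.
  move=> vW u1W u2W vu1 vu2 gv hA2 h2; apply: (@num_matchings_tristep_gt0 V A g gsym W m v u1 u2) => //.
  have nu : u1 != u2 by apply: contraNneq gv => ->.
  apply: IHm; first by have := card_tri vW u1W u2W vu1 vu2 nu; arith.
  by have := card_triA vW u1W u2W vu1 vu2 nu; arith.
case: (eqVneq (g x z) (g x y1)) => hz.
  apply: (step x z y2); rewrite ?xA ?(negbTE zA) ?y2A //; last by rewrite hz.
  by rewrite eq_sym nzA.
apply: (step x z y1); rewrite ?xA ?(negbTE zA) ?y1A //.
by rewrite eq_sym nzA.
Qed.

End Existence.

(** In a descending list the first [j.+1] values are all at least the [j]-th one. *)
Lemma sorted_nth_sum (T : Type) (x0 : T) (f : T -> nat) (s : seq T) j :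
  sorted (fun x y => f y <= f x) s -> j < size s ->
  j.+1 * f (nth x0 s j) <= \sum_(x <- s) f x.
Proof.
elim: s j => // x s IHs j /= pxs; rewrite big_cons.
have ss := path_sorted pxs.
case: j => [|j] /= js; first by rewrite mul1n leq_addr.
rewrite mulSn; apply: leq_add; last exact: IHs.
have /order_path_min : transitive (fun x y => f y <= f x).
  by move=> y z t h1 h2; apply: leq_trans h2 h1.
by move=> /(_ _ _ pxs)/(all_nthP x0)/(_ j js).
Qed.

Lemma leq_sum_uniq (T : finType) (f : T -> nat) (s : seq T) (Z : {set T}) :
  uniq s -> {subset s <= Z} -> \sum_(x <- s) f x <= \sum_(x in Z) f x.
Proof.
move=> us sZ; rewrite big_uniq //= big_mkcond [X in _ <= X]big_mkcond /=.
apply: leq_sum => x _; case: ifP => // /sZ ->; exact: leqnn.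
Qed.

(** * Outer vertices and the colors of their edges to the class *)

Section Degrees.

Variables (V : finType) (A : {set V}) (g : rel V).
Hypothesis gsym : symmetric g.

Implicit Types (b : bool) (W X Y K H : {set V}) (M : {set {set V}}) (e : {set V}) (v x y z : V) (m k : nat).

Local Notation matchings := (matchings A g).
Local Notation num_matchings := (num_matchings A g).

Definition deg b W z : nat := #|[set x in A :&: W | g z x == b]|.

(** The defect of [z]: how many of its edges to the class would have to change color for all of them
    to agree. *)
Definition minority W z : nat := minn (deg true W z) (deg false W z).

Lemma minority_bool b W z : minority W z = minn (deg b W z) (deg (~~ b) W z).
Proof. by case: b; rewrite // minnC. Qed.

Lemma deg_sum b W z : deg b W z + deg (~~ b) W z = #|A :&: W|.
Proof.
rewrite -(cardsID [set x | g z x == b] (A :&: W)) /deg; congr (_ + _); apply: eq_card => x.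
  by rewrite !inE.
by rewrite !inE andbC; case: (g z x); case: b.
Qed.

Lemma deg_mono b W W' z : W' \subset W -> deg b W' z <= deg b W z.
Proof.
move=> sW; apply: subset_leq_card; apply/subsetP=> x; rewrite !inE.
by case/andP=> /andP[-> /(subsetP sW) ->].
Qed.

Lemma minority_half W z : (minority W z).*2 <= #|A :&: W|.
Proof. by have /= := deg_sum true W z; rewrite /minority => ?; arith. Qed.

Lemma deg_bigE b W z : deg b W z = \sum_(x in A :&: W) (g z x == b : nat).
Proof. by rewrite /deg -sum1dep_card big_mkcondr. Qed.

(** A class vertex [v] is joined to [x] in color [b] and to [y] in the other color unless it is an
    exception for [x] or for [y]. Removing the triple uses one class vertex, which explains the
    summand [j] in the condition on the [j]-th pair. *)
Lemma num_matchings_gt0_pairs b W m (w : V -> nat) (v0 : V) (xs ys : seq V) :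
  size xs = size ys -> uniq (xs ++ ys) -> {subset xs ++ ys <= W :\: A} ->
  (forall x, x \in xs -> deg (~~ b) W x <= w x) ->
  (forall y, y \in ys -> deg b W y <= w y) ->
  (forall j, j < size xs -> w (nth v0 xs j) + w (nth v0 ys j) + j < #|A :&: W|) ->
  (forall W', #|W'| + 3 * size xs = #|W| -> #|A :&: W'| + size xs = #|A :&: W| ->
    0 < num_matchings W' m) ->
  0 < num_matchings W (m + size xs).
Proof.
elim: xs ys W => [|x xs IH] [|y ys] W //=; first by move=> _ _ _ _ _ _ h; rewrite addn0; apply: h; rewrite ?muln0 ?addn0.
move=> [sz] uxy sW hx hy hj hW.
have xW : x \in W :\: A by apply: sW; rewrite inE eqxx.
have yW : y \in W :\: A by apply: sW; rewrite inE mem_cat mem_head !orbT.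
have h0 := hj 0 isT; rewrite /= addn0 in h0.
have hx0 := hx x (mem_head _ _); have hy0 := hy y (mem_head _ _).
have /set0Pn[v] : [set v in A :&: W | (g x v == b) && (g y v == ~~ b)] != set0.
  rewrite -card_gt0; have := deg_sum b W x.
  have : deg b W x <= #|[set v in A :&: W | (g x v == b) && (g y v == ~~ b)]| + deg b W y.
    apply: leq_trans (leq_card_setU _ _); apply: subset_leq_card.
    apply/subsetP=> v; rewrite !inE => /andP[-> ->] /=.
    by case: (g y v); case: b {hx hy hx0 hy0 IH hW}.
  by move=> ? ?; arith.
rewrite !inE => /andP[/andP[vA vW] /andP[/eqP gxv /eqP gyv]].
case/setDP: xW => xW xA; case/setDP: yW => yW yA.
have nA z : z \notin A -> v != z by apply: contraNneq => <-.
have nxy : x != y by apply: contraTneq uxy => ->; rewrite mem_cat mem_head orbT.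
rewrite addnS; apply: (@num_matchings_tristep_gt0 V A g gsym W _ v x y); rewrite ?vA ?nA //.
  by rewrite gsym gxv gsym gyv; case: (b).
have cW := card_tri vW xW yW (nA _ xA) (nA _ yA) nxy.
have cA := card_triA A vW xW yW (nA _ xA) (nA _ yA) nxy.
rewrite vA (negbTE xA) (negbTE yA) !addn0 in cA.
have sub z : z \in xs ++ ys -> z \in x :: xs ++ y :: ys.
  by rewrite !inE !mem_cat !inE => /orP[->|->]; rewrite ?orbT.
have perm : perm_eq (x :: xs ++ y :: ys) (x :: y :: xs ++ ys).
  by rewrite perm_cons -cat1s perm_catCA.
move: uxy; rewrite -[_ && _]/(uniq (x :: xs ++ y :: ys)) (perm_uniq perm) => /and3P[nx ny uxy].
apply: (IH ys) => //.
- move=> z hz; have := sW z (sub z hz); rewrite !inE => /andP[-> ->] /=.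
  by rewrite !andbT; apply/and3P; split; [apply: contraNneq ny => <-|apply: contraNneq nx => <-; rewrite inE hz orbT|apply: contraTneq vA => <-; have := sW z (sub z hz); rewrite inE => /andP[]].
- by move=> z hz; apply: leq_trans (deg_mono _ _ _) (hx z _); rewrite ?inE ?hz ?orbT // !setDDl subsetDl.
- by move=> z hz; apply: leq_trans (deg_mono _ _ _) (hy z _); rewrite ?inE ?hz ?orbT // !setDDl subsetDl.
- by move=> j lj; have := hj j.+1 lj => /= ?; arith.
- by move=> W' h1 h2; apply: hW; arith.
Qed.

End Degrees.

(** * Existence of a monochromatic matching when the total defect is small *)

Section Sparse.

Variables (V : finType) (A : {set V}) (g : rel V).
Hypothesis gsym : symmetric g.

Implicit Types (b : bool) (W X Y K H : {set V}) (M : {set {set V}}) (e : {set V}) (v x y z : V) (m k : nat).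

Local Notation matchings := (matchings A g).
Local Notation num_matchings := (num_matchings A g).
Local Notation deg := (deg A g).
Local Notation minority := (minority A g).

Lemma leq_sorted_sum (f : V -> nat) v0 (s : seq V) (Z : {set V}) j :
  sorted (fun x y => f y <= f x) s -> uniq s -> {subset s <= Z} -> j < size s ->
  j.+1 * f (nth v0 s j) <= \sum_(z in Z) f z.
Proof.
by move=> ss us sZ js; apply: leq_trans (sorted_nth_sum v0 ss js) (leq_sum_uniq f us sZ).
Qed.

Lemma sort_desc (f : V -> nat) (X : {set V}) m : m <= #|X| ->
  exists s : seq V, [/\ sorted (fun x y => f y <= f x) s, uniq s, {subset s <= X} & size s = m].
Proof.
move=> hm; pose s := sort (fun x y => f y <= f x) (enum X).
have ss : sorted (fun x y => f y <= f x) s by apply: sort_sorted => x y; apply: leq_total.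
exists (take m s); split.
- by apply: take_sorted.
- by rewrite take_uniq // sort_uniq enum_uniq.
- by move=> x /mem_take; rewrite mem_sort mem_enum.
- by rewrite size_takel // size_sort -cardE.
Qed.

(** The vertices of [X] are matched greedily into the class in descending order of defect, so that
    the [j]-th defect is at most (2m - 3) / (j + 1). This leaves room for a partner unless that
    defect is 1; the disjunctive hypothesis is there for this case. *)
Lemma matchings_gt0_majority b W X m (w : V -> nat) :
  X \subset W :\: A -> m <= #|X| -> m <= #|A :&: W| ->
  (m < #|A :&: W|) || (#|[set z in X | 0 < w z]| < m) ->
  (forall z, z \in X -> deg (~~ b) W z <= w z) ->
  (forall z, z \in X -> w z < #|A :&: W|) ->
  \sum_(z in X) w z + 3 <= m.*2 ->
  0 < #|matchings b W m|.
Proof.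
move=> sX mX ma hmix hw hwa hs.
have [hs' [ss us sub sz]] := sort_desc w mX.
have [v0 _] : exists v, v \in X by apply/set0Pn; rewrite -card_gt0; arith.
have := @matchings_greedy V A g gsym b W (A :&: W) hs' w v0 us.
rewrite sz; apply.
- by move=> x /sub/(subsetP sX); rewrite inE => /andP[].
- exact: subsetIr.
- exact: subsetIl.
- by move=> x /sub/(subsetP sX); rewrite !inE => /andP[/negbTE->].
- move=> h /sub hX; apply: leq_trans (hw h hX).
  by apply: subset_leq_card; apply/subsetP=> k; rewrite !inE; case: (g h k); case: b {hw}.
move=> j jm; set t := w (nth v0 hs' j).
have js : j < size hs' by rewrite sz.
have tX : nth v0 hs' j \in X by apply: sub; rewrite mem_nth.
have ta := hwa _ tX; rewrite -/t in ta.
have := leq_sorted_sum v0 ss us sub js; rewrite -/t => hsum.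
have [t0|t0] := posnP t; first by rewrite t0 add0n; apply: leq_trans ma.
case: (posnP j) => [->|j0]; first by rewrite addn0.
(* For t at least 2, the bounds 2(t + j - 1) <= t(j + 1) <= 2m - 3 force t + j < m. *)
have [t2|t2] := leqP 2 t.
  have: 2 * (t + j.+1 - 2) <= t * j.+1 by clear -t2 j0; nia.
  by move=> ?; arith.
have t1 : t = 1 by arith.
case/orP: hmix => hmix; first by rewrite t1; arith.
(* By the descending order, all of the first [j.+1] vertices have positive defect, and fewer than
   [m] vertices do. *)
suff : j.+1 <= #|[set z in X | 0 < w z]| by move=> ?; rewrite t1; arith.
have <- : size (take j.+1 hs') = j.+1 by rewrite size_takel.
rewrite cardE; apply: uniq_leq_size; first by rewrite take_uniq.
move=> x xs; rewrite mem_enum inE; rewrite sub ?(mem_take xs) //=.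
apply: leq_trans t0 _; rewrite /t.
have tr : transitive (fun x y => w y <= w x) by move=> y z u h1 h2; apply: leq_trans h2 h1.
have := index_mem x (take j.+1 hs'); rewrite xs size_takel // => ij.
have := mem_take xs; rewrite -index_mem => ih.
have ex : x = nth v0 hs' (index x (take j.+1 hs')).
  by rewrite -(nth_take v0 ij) nth_index.
rewrite ex; apply: (sorted_leq_nth tr _ _ ss) => //; rewrite ?inE //.
by apply: leq_trans js.
Qed.

(* [w] bounds the defect of each outer vertex from being joined to [A] in a single
   color. A triple made of v in [A] and two outer vertices of opposite majority
   uses up the smaller majority class; then [num_matchings_gt0_big] applies. *)
Lemma num_matchings_gt0_sparse W m (w : V -> nat) :
  #|W|.+1 = 3 * m -> m <= #|A :&: W| ->
  (m < #|A :&: W|) || (#|[set z in W :\: A | 0 < w z]| < m) ->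
  (#|A :&: W| < m.*2 -> forall z, z \in W :\: A -> minority W z <= w z) ->
  \sum_(z in W :\: A) w z + 3 <= m.*2 ->
  0 < num_matchings W m.
Proof.
move=> cW ma hmix hw hs.
case: (leqP m.*2 #|A :&: W|) => a2m.
  by apply: num_matchings_gt0_big => //; rewrite cW.
have {}hw := hw a2m.
pose Z := W :\: A; have cZ : #|A :&: W| + #|Z| = #|W|.
  by rewrite setIC cardsID.
pose maj b := [set z in Z | deg (~~ b) W z < deg b W z].
(* With this choice of [b], and with the ties put into [C], the set [B] of strict [b]-majority is no
   larger than [C]. *)
have [b hb] : exists b, #|maj b| <= #|maj (~~ b)|.
  by case: (leqP #|maj true| #|maj false|) => [?|/ltnW ?]; [exists true|exists false].
pose B := maj b; pose C := Z :\: B.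
have sBZ : B \subset Z by apply/subsetP=> z; rewrite inE => /andP[].
have sCZ : C \subset Z by apply: subsetDl.
have hBC : #|B| <= #|C|.
  apply: leq_trans hb _; apply: subset_leq_card; apply/subsetP=> z; rewrite !inE negbK.
  by case/andP=> /andP[-> ->] h /=; rewrite andbT -leqNgt ltnW.
have cBC : #|B| + #|C| = #|Z|.
  by rewrite -(cardsID B Z) (setIidPr sBZ).
have muB z : z \in B -> deg (~~ b) W z = minority W z.
  by rewrite inE (minority_bool A g b) => /andP[_ h]; apply/esym/minn_idPr/ltnW.
have muC z : z \in C -> deg b W z = minority W z.
  rewrite inE (minority_bool A g b) => /andP[h zZ]; apply/esym/minn_idPl.
  by rewrite leqNgt; apply: contra h => h; rewrite inE zZ.
have sumX (X : {set V}) : X \subset Z -> \sum_(z in X) minority W z <= \sum_(z in Z) w z.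
  move=> sX; rewrite big_mkcond [X in _ <= X]big_mkcond /=; apply: leq_sum => z _.
  by case: ifP => // /(subsetP sX) zZ; rewrite zZ hw.
have mu2 := minority_half A g W.
case: (leqP m #|C|) => hC.
  apply: leq_trans (leq_matchings_num A g (~~ b) W m).
  apply: (@matchings_gt0_majority (~~ b) W C m (minority W)) => //.
  - case/orP: hmix => [->//|hm]; apply/orP; right; apply: leq_ltn_trans hm.
    apply: subset_leq_card; apply/subsetP=> z; rewrite in_set => /andP[zC z0].
    have zZ := subsetP sCZ _ zC; rewrite in_set; apply/andP; split=> //.
    by apply: leq_trans z0 (hw z zZ).
  - by move=> z zC; rewrite negbK muC.
  - by move=> z zC; have := mu2 z; move=> ?; arith.
  - by apply: leq_trans hs; rewrite leq_add2r sumX.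
(* All of [B] is paired with vertices of [C]. Since |C| < m and |W| = 3m - 1, the size of [B] is at
   least 2m minus that of the class, so what is left of the class has at least 2(m - |B|)
   vertices. *)
have [xs [sxs uxs subx szx]] := sort_desc (minority W) (leqnn #|B|).
have [ys [sys uys suby szy]] := sort_desc (minority W) hBC.
have m2 : 2 <= m by arith.
have [v0 _] : exists v, v \in A :&: W by apply/set0Pn; rewrite -card_gt0; arith.
have := @num_matchings_gt0_pairs V A g gsym b W (m - #|B|) (minority W) v0 xs ys.
rewrite szx subnK; last by arith.
apply; rewrite ?szy //.
- rewrite cat_uniq uxs uys andbT /=; apply/hasPn=> z /suby; rewrite inE => /andP[zB _].
  by apply: contra zB => /subx.
- by move=> z; rewrite mem_cat => /orP[/subx/(subsetP sBZ)|/suby/(subsetP sCZ)].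
- by move=> z /subx/muB->.
- by move=> z /suby/muC->.
- move=> j jB.
  have hx := sorted_nth_sum v0 sxs; have hy := sorted_nth_sum v0 sys.
  have {hx} := hx j; have {hy} := hy j; rewrite szx szy => /(_ jB) hy /(_ jB) hx.
  have hsum : \sum_(z <- xs) minority W z + \sum_(z <- ys) minority W z <= \sum_(z in Z) w z.
    rewrite -big_cat /=; apply: leq_trans (_ : \sum_(z in Z) minority W z <= _); last exact: sumX.
    apply: leq_sum_uniq.
      rewrite cat_uniq uxs uys andbT /=; apply/hasPn=> z /suby; rewrite inE => /andP[zB _].
      by apply: contra zB => /subx.
    by move=> z; rewrite mem_cat => /orP[/subx/(subsetP sBZ)|/suby/(subsetP sCZ)].
  have xj : nth v0 xs j \in B by apply: subx; rewrite mem_nth ?szx.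
  have strict : (minority W (nth v0 xs j)).*2 < #|A :&: W|.
    rewrite -(muB _ xj) -(deg_sum A g b W (nth v0 xs j)).
    by move: xj; rewrite inE => /andP[_ h]; arith.
  have := mu2 (nth v0 ys j) => h2.
  (* For j = 0 the strict majority in [B] suffices. For j > 0 a failure would make the total defect
     at least (j + 1)(m + 1 - j), hence at least 2m - 2, the class having more than m vertices. *)
  have [j00|j0] := posnP j; first by arith.
  rewrite ltnNge; apply/negP=> hle.
  set p := minority W (nth v0 xs j) in hx hle; set q := minority W (nth v0 ys j) in hy hle.
  have h3 : j.+1 * (#|A :&: W| - j) <= \sum_(z in Z) w z.
    apply: leq_trans hsum; apply: leq_trans (leq_add hx hy); rewrite -mulnDr leq_mul2l.
    by apply/orP; right; arith.
  have h4 : #|A :&: W| >= m.+1 by arith.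
  have h5 : j.+2 <= m by arith.
  have h6 : m.*2 - 2 <= j.+1 * (#|A :&: W| - j).
    apply: (@leq_trans (j.+1 * (m.+1 - j))); last by rewrite leq_mul2l leq_sub2r ?orbT.
    by clear -j0 h5 m2; nia.
  by have := leq_trans h6 h3; move: hs; rewrite -/Z; clear -m2; lia.
- by move=> W' h1 h2; apply: num_matchings_gt0_big => //; arith.
Qed.

End Sparse.

(** * Falling factorials, an inequality for four sizes, and averaging *)

Lemma leq_ffact n n' k : n <= n' -> n ^_ k <= n' ^_ k.
Proof.
elim: k n n' => [|k IHk] n n' hn; first by rewrite !ffactn0.
by rewrite !ffactnS leq_mul // IHk // -!subn1 leq_sub2r.
Qed.

Lemma leq_ffact_fact n k : k <= n -> n ^_ k <= n ^_ n.
Proof. by move=> kn; rewrite ffactnn -(ffact_fact kn) leq_pmulr // fact_gt0. Qed.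

(** Let s, t, p, q be the slacks of the four sizes below m - 1; their sum is m - 3. Without S, the
    right side exceeds the left by st + tp + qs + 2m - 2, and S is at most 2m - 3. *)
Lemma unbalanced_arith a1 a2 b c m S :
  a1 < m -> a2 < m -> b < m -> c < m -> a1 + a2 + b + c + 1 = 3 * m ->
  S + 3 <= m.*2 ->
  m.-1 * (a1 + a2) + S < a1 * a2 + a1 * c + a2 * b.
Proof.
move=> h1 h2 h3 h4 hs hS.
pose s := m.-1 - a1; pose t := m.-1 - a2; pose p := m.-1 - b; pose q := m.-1 - c.
have e1 : a1 = t + p + q + 2 by rewrite /t /p /q; lia.
have e2 : a2 = s + p + q + 2 by rewrite /s /p /q; lia.
have e3 : b = s + t + q + 2 by rewrite /s /t /q; lia.
have e4 : c = s + t + p + 2 by rewrite /s /t /p; lia.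
have e5 : m = s + t + p + q + 3 by rewrite /s /t /p /q; lia.
move: s t p q e1 e2 e3 e4 e5 => s t p q e1 e2 e3 e4 e5.
by subst; clear -hS; nia.
Qed.

Lemma exists_few (V : finType) (K X : {set V}) (f : V -> V -> bool) e S :
  \sum_(x in X) #|[set v in K | f v x]| <= S -> S < e.+1 * #|K| ->
  exists2 v, v \in K & #|[set x in X | f v x]| <= e.
Proof.
move=> hS hK.
have [/existsP[v /andP[vK hv]]|hN] := boolP [exists v, (v \in K) && (#|[set x in X | f v x]| <= e)].
  by exists v.
suff: e.+1 * #|K| <= S by rewrite leqNgt hK.
apply: leq_trans hS.
under eq_bigr => x _ do rewrite -sum1dep_card.
rewrite (exchange_big_dep (mem K)) /=; last by move=> x v _ /andP[].
rewrite mulnC -sum_nat_const; apply: leq_sum => v vK.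
rewrite -(@leq_pmul2l 1) // !mul1n.
have: e < #|[set x in X | f v x]|.
  by rewrite ltnNge; apply: contra hN => h; apply/existsP; exists v; rewrite vK.
move=> h; apply: leq_trans h _; rewrite -sum1dep_card.
by apply/eq_leq; apply: eq_bigl => x; rewrite vK.
Qed.

(** * Counting matchings between the class and outer vertices of one majority color *)

Section Chain.

Variables (V : finType) (A : {set V}) (g : rel V).
Hypothesis gsym : symmetric g.

Implicit Types (b : bool) (W X Y K H : {set V}) (M : {set {set V}}) (v x y z : V) (m k : nat).

Local Notation matchings := (matchings A g).
Local Notation num_matchings := (num_matchings A g).
Local Notation deg := (deg A g).
Local Notation minority := (minority A g).

(** By averaging, some class vertex [v] is joined in color [b] to all but [e] vertices [x] of [X].
    Each such edge [vx] is completed by a matching of the rest, where the hypotheses persist with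
    [k] lowered; at k = 0 existence is enough. *)
Lemma matchings_chain b W X m0 k e (w : V -> nat) :
  X \subset W :\: A -> m0 + k <= #|X| -> m0 + k <= #|A :&: W| ->
  (m0 + k < #|A :&: W|) || (#|[set z in X | 0 < w z]| < m0) ->
  (forall z, z \in X -> deg (~~ b) W z <= w z) ->
  (forall z, z \in X -> w z + k < #|A :&: W|) ->
  \sum_(z in X) w z + 3 <= m0.*2 -> \sum_(z in X) w z < e.+1 * m0 ->
  (m0 + k - e) ^_ k <= #|matchings b W (m0 + k)|.
Proof.
elim: k W X => [|k IHk] W X sX mX ma hmix hw hwa hs he.
  rewrite ffactn0 addn0; apply: (@matchings_gt0_majority V A g gsym b W X m0 w);
    rewrite ?addn0 // in mX ma hmix *.
  by move=> z zX; have := hwa z zX; rewrite addn0.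
have [v vK hv] : exists2 v, v \in A :&: W & #|[set x in X | g v x != b]| <= e.
  apply: (@exists_few V _ _ (fun v x => g v x != b) e (\sum_(z in X) w z)).
    apply: leq_sum => x xX; apply: leq_trans (hw x xX); apply: subset_leq_card.
    apply/subsetP=> y; rewrite !inE gsym => /andP[-> h] /=.
    by move: h; case: (g x y); case: (b).
  apply: leq_trans he _; rewrite leq_mul2l /=; apply: leq_trans ma.
  by rewrite leq_addr.
have [vA vW] := setIP vK.
pose Y := [set x in X | g v x == b].
have cY : #|Y| + e >= #|X|.
  rewrite -(cardsID [set x | g v x == b] X); apply: leq_add.
    by apply: subset_leq_card; apply/subsetP=> x; rewrite !inE.
  apply: leq_trans hv; apply: subset_leq_card; apply/subsetP=> x; rewrite !inE andbC.
  by move=> /andP[-> ->].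
have XW x : x \in X -> x \in W /\ x \notin A.
  by move/(subsetP sX); rewrite inE => /andP[-> ->].
have vX : v \notin X by apply/negP=> /XW[_]; rewrite vA.
rewrite addnS; have := @matchings_pairstep V A g gsym b W (m0 + k) v Y vW.
have sYW : Y \subset W by apply/subsetP=> x; rewrite inE => /andP[/XW[]].
have vY : v \notin Y by rewrite inE negb_and vX.
have hY x : x \in Y -> g v x = b /\ (v \in A) || (x \in A).
  by rewrite inE vA => /andP[_ /eqP].
move/(_ sYW vY hY); apply: leq_trans.
apply: (@leq_trans (\sum_(x in Y) (m0 + k - e) ^_ k)).
  rewrite sum_nat_const ffactnS; apply: leq_mul; first by arith.
  by apply: leq_ffact; arith.
apply: leq_sum => x; rewrite inE => /andP[xX /eqP gvx]; have [xW xA] := XW x xX.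
have eA : A :&: (W :\ v :\ x) = (A :&: W) :\ v.
  apply/setP=> y; rewrite !inE; case: (eqVneq y x) => [->|_] /=; last by case: (y == v); rewrite ?andbF.
  by rewrite (negbTE xA) /= ?andbF.
have cA : #|A :&: (W :\ v :\ x)| + 1 = #|A :&: W|.
  by rewrite eA (cardsD1 v (A :&: W)) vK addnC.
have cX : #|X :\ x| + 1 = #|X| by rewrite (cardsD1 x X) xX addnC.
have hsX : \sum_(z in X :\ x) w z <= \sum_(z in X) w z.
  by rewrite [X in _ <= X](big_setD1 x) //= leq_addl.
apply: (IHk _ (X :\ x)).
- apply/subsetP=> y; rewrite !inE => /andP[-> yX]; have [-> yA] := XW y yX.
  by rewrite yA /= andbT; apply: contraNneq vX => <-.
- by arith.
- by arith.
- case/orP: hmix => hmix; apply/orP; [left; arith|right].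
  apply: leq_ltn_trans hmix; apply: subset_leq_card; apply/subsetP=> y; rewrite !inE.
  by case/andP=> /andP[_ ->].
- move=> z; rewrite inE => /andP[_ zX]; apply: leq_trans (hw z zX).
  by apply: deg_mono; rewrite setDDl subsetDl.
- by move=> z; rewrite inE => /andP[_ zX]; have := hwa z zX => ?; arith.
- by arith.
- by apply: leq_ltn_trans he.
Qed.

End Chain.

(** * Ingredients of the recursive count *)

Section Engine.

Variables (V : finType) (A : {set V}) (g : rel V).
Hypothesis gsym : symmetric g.

Implicit Types (b : bool) (W X Y Z K H S : {set V}) (M : {set {set V}}) (v x y z : V) (m k : nat).

Local Notation matchings := (matchings A g).
Local Notation num_matchings := (num_matchings A g).
Local Notation deg := (deg A g).
Local Notation minority := (minority A g).

Definition nbr b W v : {set V} := [set x in W :\ v | g v x == b].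

Lemma nbr_sum b W v : v \in W -> #|nbr b W v| + #|nbr (~~ b) W v| + 1 = #|W|.
Proof.
move=> vW; rewrite (cardsD1 v W) vW addnC; congr (_ + _).
rewrite -[RHS](cardsID [set x | g v x == b]); congr (_ + _); apply: eq_card => x.
  by rewrite !inE.
by rewrite !inE [RHS]andbC; case: (g v x); case: b.
Qed.

(** A vertex of [S] has at least 2m - 1 edges of color [b] in [W]. At most m - 1 of them end in the
    chosen m-subset [H], so m partners remain outside [H]. *)
Lemma matchings_large_degree b W S m :
  #|W|.+1 = 3 * m -> S \subset A :&: W -> m <= #|S| ->
  (forall v, v \in S -> #|nbr (~~ b) W v| < m) ->
  m ^_ m <= #|matchings b W m|.
Proof.
move=> cW sS mS hS; have [H sH cH] := subset_of_size mS.
have HW : H \subset W.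
  by apply: subset_trans sH (subset_trans sS _); apply: subsetIr.
apply: (@matchings_many V A g gsym b W H (W :\: H) m m); rewrite ?cH //.
- exact: subsetDl.
- by rewrite disjoints_subset; apply/subsetP=> x xH; rewrite !inE xH.
- move=> h hH; have hW := subsetP HW h hH.
  have h1 := nbr_sum b hW; have h2 := hS h (subsetP sH h hH).
  have h3 : #|nbr b W h| <= #|[set k in W :\: H | g h k == b]| + #|H :\ h|.
    apply: leq_trans (leq_card_setU _ _); apply: subset_leq_card.
    apply/subsetP=> x; rewrite !inE => /andP[/andP[nx xW] gx].
    by rewrite nx xW gx; case: (x \in H).
  have h4 := cardsD1 h H; rewrite hH in h4.
  by arith.
- move=> h k hH _; apply/orP; left.
  by have /setIP[] := subsetP sS h (subsetP sH h hH).
Qed.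

Section Step.

Variables (n m0 d e : nat) (w : V -> nat).
Hypotheses (d1 : d <= 1)
  (hw : forall W, #|A :&: W| < n.*2 -> forall z, z \notin A -> minority W z <= w z)
  (hs : \sum_(z in ~: A) w z + 3 <= m0.*2)
  (he : \sum_(z in ~: A) w z < e.+1 * m0)
  (hmix : (d == 1) || (#|[set z in ~: A | 0 < w z]| < m0)).

Lemma sum_minority_leq W X : #|A :&: W| < n.*2 -> X \subset ~: A ->
  \sum_(z in X) minority W z <= \sum_(z in ~: A) w z.
Proof.
move=> hn sX; rewrite big_mkcond [X in _ <= X]big_mkcond /=; apply: leq_sum => z _.
case: ifP => // /(subsetP sX) zA; rewrite zA; apply: hw => //.
by move: zA; rewrite inE.
Qed.

(** This is the case of [m0 + k] outer vertices with a common majority color. The bound of the chain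
    is weakened by [d] and 1 to match the other cases of the count. *)
Lemma chain_engine b W X k :
  m0 + k <= n -> #|A :&: W| < (m0 + k).*2 -> m0 + k + d <= #|A :&: W| ->
  X \subset W :\: A -> m0 + k <= #|X| ->
  (\sum_(z in ~: A) w z == 0) || (k < m0) ->
  (forall z, z \in X -> deg (~~ b) W z <= minority W z) ->
  (m0 + k - d - e - 1) ^_ k <= num_matchings W (m0 + k).
Proof.
move=> kn a2m ma sX mX hk hX.
have an : #|A :&: W| < n.*2 by arith.
have sXA : X \subset ~: A.
  by apply: subset_trans sX _; apply/subsetP=> x; rewrite !inE => /andP[].
have hsum := sum_minority_leq an sXA.
apply: leq_trans (leq_matchings_num A g b W _).
apply: leq_trans (@matchings_chain V A g gsym b W X m0 k e (minority W) sX mX _ _ hX _ _ _).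
- by apply: leq_ffact; arith.
- by arith.
- case/orP: hmix => [/eqP d1'|hm]; apply/orP; [left; subst; arith|right].
  apply: leq_ltn_trans hm; apply: subset_leq_card; apply/subsetP=> z.
  rewrite in_set => /andP[zX z0]; rewrite in_set; have zA := subsetP sXA z zX.
  rewrite zA /=; apply: leq_trans z0 _; apply: hw => //.
  by move: zA; rewrite inE.
- move=> z zX; have h2 := minority_half A g W z.
  case/orP: hk => [/eqP h0|h0]; last by arith.
  suff : minority W z = 0 by move=> ->; arith.
  apply/eqP; rewrite -leqn0 -h0; apply: leq_trans hsum.
  by rewrite (big_setD1 z) //= leq_addr.
- by arith.
- exact: leq_ltn_trans hsum he.
Qed.

End Step.

(* Double counting of the edges of the minority color at [A1] and at [A2]. *)
Lemma unbalanced_count W (A1 A2 B C : {set V}) m (s : nat) :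
  A1 :|: A2 \subset A :&: W -> [disjoint A1 & A2] -> B \subset W :\: A -> C \subset W :\: A ->
  (forall v, v \in A1 -> #|nbr false W v| < m) ->
  (forall v, v \in A2 -> #|nbr true W v| < m) ->
  \sum_(z in B) deg false W z + \sum_(z in C) deg true W z <= s ->
  #|A1| * #|A2| + #|A1| * #|C| + #|A2| * #|B| <= m.-1 * (#|A1| + #|A2|) + s.
Proof.
move=> sA dA sB sC hA1 hA2 hS.
have cross b X Y : \sum_(x in X) \sum_(y in Y) (g x y == b : nat) +
    \sum_(y in Y) \sum_(x in X) (g y x == ~~ b : nat) = #|X| * #|Y|.
  rewrite [X in _ + X]exchange_big /= -big_split /= -sum_nat_const; apply: eq_bigr => x _.
  rewrite -big_split /= -sum1_card; apply: eq_bigr => y _.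
  by rewrite (gsym y x); case: (g x y); case: b.
have bound b X Y : X \subset A :&: W ->
    \sum_(y in Y) \sum_(x in X) (g y x == b : nat) <= \sum_(y in Y) deg b W y.
  move=> sX; apply: leq_sum => y _; rewrite deg_bigE; apply: sub_le_big => //= [? ?|x /(subsetP sX)//].
  exact: leq_addr.
have deg2 b X Y Z : [disjoint X & Y] -> [disjoint X & Z] -> [disjoint Y & Z] ->
    X :|: Y :|: Z \subset W -> (forall v, v \in X -> #|nbr b W v| < m) ->
    \sum_(x in X) \sum_(y in Y) (g x y == b : nat) +
    \sum_(x in X) \sum_(y in Z) (g x y == b : nat) <= m.-1 * #|X|.
  move=> dXY dXZ dYZ sW hX; rewrite -big_split /= mulnC -sum_nat_const.
  apply: leq_sum => x xX; have := hX x xX => hx.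
  rewrite -bigU //=; apply: (@leq_trans #|nbr b W x|); last by arith.
  rewrite -sum1dep_card -big_mkcondr /=; apply: sub_le_big => //= [? ?|y /andP[]].
    by rewrite leq_addr.
  rewrite !inE => yYZ gx; rewrite gx andbT; apply/andP; split.
    apply: contraTneq yYZ => ->.
    by rewrite (disjointFr dXY xX) (disjointFr dXZ xX).
  by apply: (subsetP sW); rewrite !inE -orbA yYZ orbT.
have sW X Y Z : X \subset A :&: W -> Y \subset A :&: W -> Z \subset W :\: A ->
    X :|: Y :|: Z \subset W /\ [disjoint X & Z].
  move=> sX sY sZ; split.
    rewrite !subUset (subset_trans sX (subsetIr _ _)) (subset_trans sY (subsetIr _ _)).
    by rewrite (subset_trans sZ (subsetDl _ _)).
  apply: disjointWl sX _; apply: disjointWr sZ _; rewrite -setI_eq0; apply/eqP/setP=> z.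
  by rewrite !inE; case: (z \in A); rewrite ?andbF.
move: sA; rewrite subUset => /andP[s1 s2].
have [sW1 d1C] := sW _ _ _ s1 s2 sC; have [_ d2C] := sW _ _ _ s2 s1 sC.
have [sW2 d2B] := sW _ _ _ s2 s1 sB; have [_ d1B] := sW _ _ _ s1 s2 sB.
have e1 := deg2 false _ _ _ dA d1C d2C sW1 hA1.
have dA' : [disjoint A2 & A1] by rewrite disjoint_sym.
have e2 := deg2 true _ _ _ dA' d2B d1B sW2 hA2.
have c12 := cross false A1 A2; have c1C := cross false A1 C; have c2B := cross true A2 B.
have b1 := bound true A1 C s1; have b2 := bound false A2 B s2.
rewrite mulnDr; rewrite /= in c12 c1C c2B.
by arith.
Qed.

End Engine.

(** * The recursive count of monochromatic matchings *)

Section Counting.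

Variables (V : finType) (A : {set V}) (g : rel V).
Hypothesis gsym : symmetric g.

Implicit Types (b : bool) (W X Y Z K H S : {set V}) (M : {set {set V}}) (v x y z : V) (m k : nat).

Local Notation matchings := (matchings A g).
Local Notation num_matchings := (num_matchings A g).
Local Notation deg := (deg A g).
Local Notation minority := (minority A g).
Local Notation nbr := (nbr g).

(* Each of the k steps gains a factor and leads from m to m - 1, down to [m0], where
   mere existence suffices. [e] is 0 if all outer vertices are pure (w = 0), else 1.
   With d = 1 the class [A] stays larger than m, which replaces the bound on the
   number of impure vertices. *)
Lemma num_matchings_engine n m0 k d e (w : V -> nat) W :
  d <= 1 ->
  (forall W, #|A :&: W| < n.*2 -> forall z, z \notin A -> minority W z <= w z) ->
  \sum_(z in ~: A) w z + 3 <= m0.*2 ->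
  \sum_(z in ~: A) w z < e.+1 * m0 ->
  (d == 1) || (#|[set z in ~: A | 0 < w z]| < m0) ->
  (\sum_(z in ~: A) w z == 0) || (k < m0) ->
  m0 + k <= n -> #|W|.+1 = 3 * (m0 + k) -> m0 + k + d <= #|A :&: W| ->
  (m0 + k - d - e - 1) ^_ k <= num_matchings W (m0 + k).
Proof.
move=> d1 hw hs he hmix; elim: k W => [|k IHk] W hk kn cW ma.
  rewrite ffactn0 addn0 in cW ma kn *; have sZ : W :\: A \subset ~: A.
    by apply/subsetP=> x; rewrite !inE => /andP[].
  apply: (@num_matchings_gt0_sparse V A g gsym W m0 w) => //.
  - by arith.
  - case/orP: hmix => [/eqP d1'|hm]; apply/orP; [left; subst; arith|right].
    apply: leq_ltn_trans hm; apply: subset_leq_card; apply/subsetP=> z.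
    rewrite in_set => /andP[zX z0]; rewrite in_set z0 andbT.
    exact: subsetP sZ z zX.
  - move=> a2m z zZ; apply: hw; first by arith.
    by have := subsetP sZ z zZ; rewrite inE.
  - apply: leq_trans hs; rewrite leq_add2r big_mkcond [X in _ <= X]big_mkcond /=.
    by apply: leq_sum => z _; case: ifP => // /(subsetP sZ)->.
have {}IHk : forall W, #|W|.+1 = 3 * (m0 + k) -> m0 + k + d <= #|A :&: W| ->
    (m0 + k - d - e - 1) ^_ k <= num_matchings W (m0 + k).
  by move=> W'; apply: IHk; [case/orP: hk => [->//|h]; apply/orP; right; arith|arith].
set m := m0 + k.+1 in kn cW ma *.
have em : m = (m0 + k).+1 by rewrite /m addnS.
pose Z := W :\: A; have cZ : #|A :&: W| + #|Z| = #|W| by rewrite setIC cardsID.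
pose B := [set z in Z | deg false W z < deg true W z]; pose C := Z :\: B.
have sBZ : B \subset Z by apply/subsetP=> z; rewrite inE => /andP[].
have sCZ : C \subset Z by apply: subsetDl.
have cBC : #|B| + #|C| = #|Z| by rewrite -(cardsID B Z) (setIidPr sBZ).
have muB z : z \in B -> deg false W z = minority W z.
  by rewrite inE => /andP[_ h]; apply/esym/minn_idPr/ltnW.
have muC z : z \in C -> deg true W z = minority W z.
  rewrite inE => /andP[h zZ]; apply/esym/minn_idPl.
  by rewrite leqNgt; apply: contra h => h; rewrite inE zZ.
have sZA : Z \subset ~: A by apply/subsetP=> x; rewrite !inE => /andP[].
have hk' : (\sum_(z in ~: A) w z == 0) || (k.+1 < m0) by [].
case: (leqP m #|C|) => hC.
  apply: (@chain_engine V A g gsym n m0 d e w d1 hw hs he hmix false W C k.+1) => //.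
    by rewrite -/m; arith.
  by move=> z /muC /= ->.
case: (leqP m #|B|) => hB.
  apply: (@chain_engine V A g gsym n m0 d e w d1 hw hs he hmix true W B k.+1) => //.
    by rewrite -/m; arith.
  by move=> z /muB /= ->.
have hsum : #|A :&: W| < m.*2 ->
    \sum_(z in B) deg false W z + \sum_(z in C) deg true W z <= \sum_(z in ~: A) w z.
  move=> a2m; rewrite (eq_bigr _ muB) (eq_bigr _ muC).
  apply: leq_trans (@sum_minority_leq V A g n w hw W Z _ sZA); last by arith.
  by rewrite [leqRHS](big_setID B) /= (setIidPr sBZ).
have step v X Y t : v \in A :&: W -> X \subset nbr true W v -> Y \subset nbr false W v ->
    t <= #|X| -> t <= #|Y| -> m - d - e - 1 <= t ->
    (forall x y, x \in X -> y \in Y -> (x \in A) + (y \in A) + m + d <= #|A :&: W|) ->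
    (m - d - e - 1) ^_ k.+1 <= num_matchings W m.
  move=> /setIP[vA vW] sX sY tX tY ht ha; rewrite em.
  apply: (@leq_trans (t * (m0 + k - d - e - 1) ^_ k)).
    by rewrite ffactnS -em leq_mul // leq_ffact // -subn1; clear -em; lia.
  have hX x : x \in X -> [/\ v != x, x \in W & g v x = true].
    by move/(subsetP sX); rewrite !inE eq_sym => /andP[/andP[-> ->] /eqP].
  have hY x : x \in Y -> [/\ v != x, x \in W & g v x = false].
    by move/(subsetP sY); rewrite !inE eq_sym => /andP[/andP[-> ->] /eqP].
  apply: (@num_matchings_tristep V A g gsym W (m0 + k) v X Y) => //.
  - by apply/subsetP=> x /hX[].
  - by apply/subsetP=> x /hY[].
  - by apply/negP=> /hX[]; rewrite eqxx.
  - by apply/negP=> /hY[]; rewrite eqxx.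
  - by move=> x /hX[_ _ ->]; rewrite vA.
  - by move=> x /hY[_ _ ->]; rewrite vA.
  move=> x y xX yY; have [vx xW gx] := hX x xX; have [vy yW gy] := hY y yY.
  have xy : x != y by apply: contraTneq gx => ->; rewrite gy.
  have c1 := card_tri vW xW yW vx vy xy; have c2 := card_triA A vW xW yW vx vy xy.
  have c3 := ha x y xX yY; rewrite vA in c2.
  by apply: IHk; arith.
(* A class this small cannot lose three vertices, so [X] and [Y] are taken outside it. As [B] and
   [C] have fewer than m vertices each, both have at least m - 1 - d, and some class vertex [v] is
   joined to all but [e] outer vertices in their majority colors. Hence the factor m - d - e - 1. *)
case: (leqP #|A :&: W| (m + 1 + d)) => ha.
  have m03 : 2 <= m0 by arith.
  have a2m : #|A :&: W| < m.*2 by arith.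
  have hsum' := hsum a2m.
  have [v vK hv] : exists2 v, v \in A :&: W &
      #|[set x in Z | g v x != (x \in B)]| <= e.
    apply: (@exists_few V _ _ (fun v x => g v x != (x \in B)) e (\sum_(z in ~: A) w z)).
      apply: leq_trans hsum'; rewrite [leqLHS](big_setID B) /= (setIidPr sBZ); apply: leq_add.
        apply: leq_sum => x xB; apply: subset_leq_card; apply/subsetP=> y.
        by rewrite xB !inE gsym => /andP[-> /=]; case: (g x y).
      apply: leq_sum => x xC; apply: subset_leq_card; apply/subsetP=> y.
      have /setDP[_ /negbTE ->] := xC.
      by rewrite !inE gsym => /andP[-> /=]; case: (g x y).
    apply: leq_trans he _; rewrite leq_mul2l /=.
    by apply: leq_trans ma; rewrite /m; clear; lia.
  have [vA vW] := setIP vK.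
  pose X := [set x in B | g v x]; pose Y := [set y in C | ~~ g v y].
  have nv z : z \in Z -> z != v by rewrite inE => /andP[h _]; apply: contraNneq h => ->.
  have zW z : z \in Z -> z \in W by rewrite inE => /andP[].
  have cX : #|B| <= #|X| + e.
    rewrite -(cardsID [set x | g v x] B); apply: leq_add.
      by apply: subset_leq_card; apply/subsetP=> x /setIP[xB]; rewrite in_set => gx; rewrite in_set xB gx.
    apply: leq_trans hv; apply: subset_leq_card; apply/subsetP=> x.
    by rewrite in_setD in_set => /andP[h xB]; rewrite in_set (subsetP sBZ) // xB; case: (g v x) h.
  have cY : #|C| <= #|Y| + e.
    rewrite -(cardsID [set x | ~~ g v x] C); apply: leq_add.
      by apply: subset_leq_card; apply/subsetP=> x /setIP[xB]; rewrite in_set => gx; rewrite in_set xB gx.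
    apply: leq_trans hv; apply: subset_leq_card; apply/subsetP=> x.
    rewrite in_setD in_set => /andP[h xC]; have /setDP[xZ /negbTE xB] := xC.
    by rewrite in_set xZ xB; case: (g v x) h.
  apply: (step v X Y (m - d - e - 1)) => //.
  - apply/subsetP=> x; rewrite in_set => /andP[/(subsetP sBZ) xZ gx].
    by rewrite !inE nv // zW // gx.
  - apply/subsetP=> x; rewrite in_set => /andP[/(subsetP sCZ) xZ gx].
    by rewrite !inE nv // zW // (negbTE gx).
  - by arith.
  - by arith.
  - move=> x y; rewrite in_set => /andP[/(subsetP sBZ) xZ _].
    rewrite in_set => /andP[/(subsetP sCZ) yZ _].
    have /setDP[_ /negbTE->] := xZ; have /setDP[_ /negbTE->] := yZ.
    by rewrite !add0n.
(* From here on the class is large enough to lose a whole triple, so any vertex with m edges of each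
   color gives the factor m. *)
have [/existsP[v /and3P[vK h1 h2]]|hN] :=
    boolP [exists v, [&& v \in A :&: W, m <= #|nbr true W v| & m <= #|nbr false W v|]].
  apply: (step v (nbr true W v) (nbr false W v) m) => //.
    by clear; lia.
  move=> x y _ _; have := leq_b1 (x \in A); have := leq_b1 (y \in A).
  by move: (x \in A : nat) (y \in A : nat) => p q ? ?; arith.
have hmm b : m ^_ m <= #|matchings b W m| -> (m - d - e - 1) ^_ k.+1 <= num_matchings W m.
  move=> h; apply: leq_trans (leq_matchings_num A g b W m); apply: leq_trans h.
  apply: (@leq_trans (m ^_ k.+1)); last by apply: leq_ffact_fact; rewrite /m; clear; lia.
  by apply: leq_ffact; clear; lia.
(* Every class vertex now has fewer than m edges of one color. If both parts have fewer than m
   vertices, the double count contradicts [unbalanced_arith]. *)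
pose A1 := [set v in A :&: W | #|nbr false W v| < m]; pose A2 := (A :&: W) :\: A1.
have s1 : A1 \subset A :&: W by apply/subsetP=> v; rewrite in_set => /andP[].
have h1 v : v \in A1 -> #|nbr false W v| < m by rewrite in_set => /andP[].
have h2 v : v \in A2 -> #|nbr true W v| < m.
  rewrite in_setD => /andP[vA1 vK]; rewrite ltnNge; apply/negP=> hv; case/negP: hN.
  apply/existsP; exists v; rewrite vK hv /=.
  by move: vA1; rewrite in_set vK /= -leqNgt.
case: (leqP m #|A1|) => hA1.
  apply: (hmm true); apply: (@matchings_large_degree V A g gsym true W A1 m) => //.
case: (leqP m #|A2|) => hA2.
  by apply: (hmm false); apply: (@matchings_large_degree V A g gsym false W A2 m); rewrite ?subsetDl.
have cA : #|A1| + #|A2| = #|A :&: W|.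
  by rewrite -(cardsID A1 (A :&: W)) (setIidPr s1).
have dA : [disjoint A1 & A2].
  by rewrite disjoints_subset; apply/subsetP=> v vA1; rewrite in_setC in_setD vA1.
have sA12 : A1 :|: A2 \subset A :&: W by rewrite subUset s1 subsetDl.
have a2m : #|A :&: W| < m.*2 by arith.
have := @unbalanced_count V A g gsym W A1 A2 B C m _ sA12 dA sBZ sCZ h1 h2 (hsum a2m).
rewrite leqNgt unbalanced_arith //; first by arith.
by move: hs; rewrite /m => ?; arith.
Qed.

End Counting.

(** * Copies of the star and of the matching *)

Section Copies.

Variables (N : nat) (c : coloring 3 N).
Local Notation V := (complete N).

Implicit Types (v x y z : V) (S : {set V} * {set {set V}}).

Definition col x y : 'I_3 := c [set x; y].

Lemma col_sym x y : col x y = col y x.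
Proof. by rewrite /col setUC. Qed.

Definition color_nbr v (i : 'I_3) : {set V} := [set x | (x != v) && (col v x == i)].

Lemma edge_complete x y : x != y -> [set x; y] \in edges V.
Proof. by move=> xy; apply/imset2P; exists x y; rewrite // inE. Qed.

Lemma edges_star3 (e : {set star3}) : e \in edges star3 ->
  exists2 q : 'I_4, q != ord0 & e = [set ord0; q].
Proof.
case/imset2P=> p q _; rewrite inE /= /star3_adj => pq ->.
have [p0|p0] := eqVneq p ord0; rewrite ?p0 ?(negbTE p0) /= in pq *.
  by exists q => //; rewrite p0.
by exists p => //; rewrite (eqP pq) setUC.
Qed.

Lemma star3_edge (q : 'I_4) : q != ord0 -> [set (ord0 : star3); q] \in edges star3.
Proof.
by move=> q0; apply/imset2P; exists (ord0 : star3) q; rewrite // !inE /= /star3_adj eqxx (negbTE q0).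
Qed.

Definition star v x y z : {set V} * {set {set V}} :=
  ([set v; x; y; z], [set [set v; x]; [set v; y]; [set v; z]]).

Lemma star_rainbow v x y z :
  x \in color_nbr v (inord 0) -> y \in color_nbr v (inord 1) -> z \in color_nbr v (inord 2) ->
  star v x y z \in rainbow_copies c star3.
Proof.
rewrite !inE => /andP[xv /eqP cx] /andP[yv /eqP cy] /andP[zv /eqP cz].
have n01 : inord 0 != inord 1 :> 'I_3 by rewrite -val_eqE /= !inordK.
have n02 : inord 0 != inord 2 :> 'I_3 by rewrite -val_eqE /= !inordK.
have n12 : inord 1 != inord 2 :> 'I_3 by rewrite -val_eqE /= !inordK.
have xy : x != y by apply: contraNneq n01 => exy; rewrite -cx -cy exy.
have xz : x != z by apply: contraNneq n02 => exy; rewrite -cx -cz exy.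
have yz : y != z by apply: contraNneq n12 => exy; rewrite -cy -cz exy.
apply/andP; split; last first.
  apply/forall_inP=> e; rewrite !inE => he; apply/forall_inP=> f; rewrite !inE => hf.
  apply/implyP=> /eqP; move: cx cy cz; rewrite /col => cx cy cz.
  by case/orP: he => [/orP[]|] /eqP->; case/orP: hf => [/orP[]|] /eqP->;
    rewrite ?eqxx // ?cx ?cy ?cz => h; move: n01 n02 n12; rewrite ?h ?eqxx // -?h ?eqxx.
pose f : {ffun star3 -> V} := [ffun i : 'I_4 => nth v [:: v; x; y; z] i].
apply/existsP; exists f.
have f0 : f ord0 = v by rewrite ffunE.
have inj4 (q : 'I_4) : [|| q == ord0, q == inord 1, q == inord 2 | q == inord 3].
  by case: q => [[|[|[|[|q]]]] hq] //; rewrite -!val_eqE /= ?inordK.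
have f1 : f (inord 1 : 'I_4) = x by rewrite ffunE inordK.
have f2 : f (inord 2 : 'I_4) = y by rewrite ffunE inordK.
have f3 : f (inord 3 : 'I_4) = z by rewrite ffunE inordK.
have img (q : star3) : f @: [set (ord0 : star3); q] = [set v; f q].
  by rewrite imsetU1 imset_set1 f0.
have nz (k : nat) : 0 < k -> k < 4 -> (inord k : 'I_4) != ord0.
  by move=> k0 k4; rewrite -val_eqE /= inordK // -lt0n.
apply/and4P; split.
- apply/injectiveP=> p q.
  case/or4P: (inj4 p) => /eqP->; case/or4P: (inj4 q) => /eqP->; rewrite ?f0 ?f1 ?f2 ?f3 //;
  move=> h; exfalso; move: xv yv zv xy xz yz; rewrite ?h ?eqxx // -?h ?eqxx //.
- apply/eqP/setP=> u; rewrite /= !inE; apply/idP/imsetP.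
    case/orP=> [/orP[/orP[]|]|] /eqP->; [exists ord0|exists (inord 1 : 'I_4)|exists (inord 2 : 'I_4)|exists (inord 3 : 'I_4)];
    by rewrite ?inE ?f0 ?f1 ?f2 ?f3.
  case=> q _ ->; case/or4P: (inj4 q) => /eqP->; rewrite ?f0 ?f1 ?f2 ?f3 eqxx ?orbT //.
- apply/eqP/setP=> e; rewrite /= !inE; apply/idP/imsetP.
    case/orP=> [/orP[]|] /eqP->.
    + by exists [set (ord0 : star3); inord 1 : 'I_4]; rewrite ?star3_edge ?nz ?img ?f1.
    + by exists [set (ord0 : star3); inord 2 : 'I_4]; rewrite ?star3_edge ?nz ?img ?f2.
    + by exists [set (ord0 : star3); inord 3 : 'I_4]; rewrite ?star3_edge ?nz ?img ?f3.
  case=> e' /edges_star3[q q0 ->] ->; rewrite img.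
  by case/or4P: (inj4 q) q0 => /eqP-> //; rewrite ?eqxx // ?f1 ?f2 ?f3 eqxx ?orbT.
- by apply/subsetP=> e; rewrite !inE => /orP[/orP[]|] /eqP->; apply: edge_complete; rewrite eq_sym.
Qed.

(** The colors of the three edges at the centre form an injection of ['I_3] into itself, which is
    onto. *)
Lemma rainbow_starP S : S \in rainbow_copies c star3 ->
  exists v, forall i : 'I_3, exists2 x, x != v & col v x = i.
Proof.
rewrite inE => /andP[]; rewrite inE => /existsP[f /and4P[/injectiveP fi _ /eqP e2 _]] /forall_inP hr.
have img (q : star3) : f @: [set (ord0 : star3); q] = [set f ord0; f q].
  by rewrite imsetU1 imset_set1.
have inS (q : 'I_4) : q != ord0 -> [set f ord0; f q] \in S.2.
  by move=> q0; rewrite e2 -img imset_f // star3_edge.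
pose h (k : 'I_3) : 'I_3 := col (f ord0) (f (lift ord0 k)).
have l0 (k : 'I_3) : lift ord0 k != ord0 :> 'I_4 by rewrite eq_sym neq_lift.
have hinj : injective h.
  move=> k1 k2 hk; have /forall_inP hr1 := hr _ (inS _ (l0 k1)).
  have /implyP := hr1 _ (inS _ (l0 k2)); move: hk; rewrite /h /col => -> /(_ (eqxx _)) /eqP /setP/(_ (f (lift ord0 k1))).
  rewrite !inE eqxx orbT => /esym/orP[/eqP/fi/eqP|/eqP/fi/lift_inj //].
  by rewrite (negbTE (l0 k1)).
exists (f ord0) => i.
have /codomP[k ->] : i \in codom h by rewrite (inj_card_onto hinj).
exists (f (lift ord0 k)) => //; apply/eqP=> /fi/eqP.
by rewrite (negbTE (l0 k)).
Qed.

(** A rainbow star determines its centre and, given the centre, its leaf in each color. *)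
Lemma leq_rainbow :
  \sum_(v : V) #|color_nbr v (inord 0)| * #|color_nbr v (inord 1)| * #|color_nbr v (inord 2)|
    <= #|rainbow_copies c star3|.
Proof.
pose D v := setX (color_nbr v (inord 0)) (setX (color_nbr v (inord 1)) (color_nbr v (inord 2))).
pose F v := [set star v p.1 p.2.1 p.2.2 | p in D v].
have n01 : inord 0 != inord 1 :> 'I_3 by rewrite -val_eqE /= !inordK.
have n02 : inord 0 != inord 2 :> 'I_3 by rewrite -val_eqE /= !inordK.
have n12 : inord 1 != inord 2 :> 'I_3 by rewrite -val_eqE /= !inordK.
have pair_eq v x x' : x != v -> [set v; x] = [set v; x'] -> x = x'.
  move=> xv /setP/(_ x); rewrite !inE eqxx orbT (negbTE xv) /=.
  by move/esym/eqP.
have cF v : #|F v| = #|color_nbr v (inord 0)| * #|color_nbr v (inord 1)| * #|color_nbr v (inord 2)|.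
  rewrite card_in_imset ?cardsX ?mulnA // => -[x [y z]] [x' [y' z']] /setXP[/= hx /setXP[/= hy hz]].
  move=> /setXP[/= hx' /setXP[/= hy' hz']] [_ /setP e2].
  move: hx hy hz hx' hy' hz'; rewrite !inE => /andP[xv /eqP cx] /andP[yv /eqP cy] /andP[zv /eqP cz].
  move=> /andP[xv' /eqP cx'] /andP[yv' /eqP cy'] /andP[zv' /eqP cz'].
  rewrite /col in cx cy cz cx' cy' cz'.
  have ex : [set v; x] = [set v; x'].
    have := e2 [set v; x]; rewrite !inE eqxx /= => /esym/orP[/orP[]|] /eqP // h;
    move: n01 n02; rewrite -cx h ?cy' ?cz' ?eqxx //.
  have ey : [set v; y] = [set v; y'].
    have := e2 [set v; y]; rewrite !inE eqxx orbT /= => /esym/orP[/orP[]|] /eqP // h;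
    move: n01 n12; rewrite -cy h ?cx' ?cz' ?eqxx //.
  have ez : [set v; z] = [set v; z'].
    have := e2 [set v; z]; rewrite !inE eqxx orbT /= => /esym/orP[/orP[]|] /eqP // h;
    move: n02 n12; rewrite -cz h ?cx' ?cy' ?eqxx //.
  by rewrite (pair_eq _ _ _ xv ex) (pair_eq _ _ _ yv ey) (pair_eq _ _ _ zv ez).
have dF v v' : v != v' -> [disjoint F v & F v'].
  move=> vv'; rewrite -setI_eq0; apply/eqP/setP=> S; rewrite !inE; apply/negP.
  case/andP=> /imsetP[[x [y z]] /setXP[/= hx /setXP[/= hy hz]] ->].
  case/imsetP=> [[x' [y' z']] _] [_ /setP e2].
  have key u : u \in [:: x; y] -> v' = u.
    move=> hu; have : [set v; u] \in [set [set v; x]; [set v; y]; [set v; z]].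
      by move: hu; rewrite !inE => /orP[] /eqP->; rewrite eqxx ?orbT.
    rewrite e2 !inE => /orP[/orP[]|] /eqP/setP/(_ v'); rewrite !inE eqxx /= => /orP[]; 
      rewrite 1?eq_sym ?(negbTE vv') // => /eqP //.
  have e1 := key x (mem_head _ _); have e3 : v' = y by apply: key; rewrite !inE eqxx orbT.
  move: hx hy; rewrite -e1 -e3 !inE => /andP[_ /eqP ->] /andP[_].
  by rewrite (negbTE n01).
under eq_bigr => v _ do rewrite -cF -sum1_card.
rewrite -(partition_disjoint_bigcup _ (fun=> 1) dF) sum1_card.
apply: subset_leq_card; apply/bigcupsP=> v _; apply/subsetP=> _ /imsetP[[x [y z]] /= hp ->].
by case/setXP: hp => /= hx /setXP[/= hy hz]; apply: star_rainbow.
Qed.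

End Copies.

Section MatchingCopies.

Variables (N n : nat) (c : coloring 3 N).
Local Notation V := (complete N).

Implicit Types (v x y z : V) (S : {set V} * {set {set V}}).

Lemma edges_matching (e : {set matching n}) : e \in edges (matching n) ->
  exists i : 'I_n, e = [set (i, false); (i, true)].
Proof.
case/imset2P=> -[i b] [j b'] _; rewrite inE /= /matching_adj /= => /andP[/eqP <- bb'] ->.
by exists i; case: b b' bb' => -[] //; rewrite setUC.
Qed.

Lemma matching_edge (i : 'I_n) :
  [set ((i, false) : matching n); (i, true)] \in edges (matching n).
Proof.
by apply/imset2P; exists ((i, false) : matching n) (i, true); rewrite // !inE /= /matching_adj /= eqxx.
Qed.

(** The embedding comes from an enumeration of [M] together with a chosen order of the two ends of
    each edge. *)
Lemma mono_copy_matchings (A : {set V}) (g : rel V) b W M (i : 'I_3) :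
  M \in matchings A g b W n -> (forall e, medge A g b e -> c e = i) ->
  (cover M, M) \in mono_copies c (matching n).
Proof.
move=> /matchingsP[cM tM _ eM] ci; rewrite inE /=; apply/andP; split; last first.
  by apply/forall_inP=> e eM'; apply/forall_inP=> f fM'; rewrite !ci // eM.
have ord_edge e : e \in M -> {p : V * V | p.1 != p.2 & e = [set p.1; p.2]}.
  move=> /eM he; have : exists p : V * V, (p.1 != p.2) && (e == [set p.1; p.2]).
    case/existsP: he => x /existsP[y /and4P[_ xy _ exy]].
    by exists (x, y); rewrite xy.
  by case/sigW=> p /andP[pp /eqP ep]; exists p.
pose ee (k : 'I_n) := enum_val (cast_ord (esym cM) k).
have eeM k : ee k \in M by apply: enum_valP.
have eeI : injective ee by move=> k l /enum_val_inj/cast_ord_inj.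
pose p k := s2val (ord_edge _ (eeM k)).
have p1 k : (p k).1 != (p k).2 by apply: (s2valP (ord_edge _ (eeM k))).
have p2 k : ee k = [set (p k).1; (p k).2] by apply: (s2valP' (ord_edge _ (eeM k))).
pose f : {ffun matching n -> V} := [ffun u : 'I_n * bool => if u.2 then (p u.1).2 else (p u.1).1].
have fE k b' : f (k, b') = if b' then (p k).2 else (p k).1 by rewrite ffunE.
have fin k b' : f (k, b') \in ee k by rewrite fE p2; case: b'; rewrite !inE eqxx ?orbT.
have img k : f @: [set ((k, false) : matching n); (k, true)] = ee k.
  by rewrite imsetU1 imset_set1 !fE p2.
rewrite inE; apply/existsP; exists f; apply/and4P; split.
- apply/injectiveP=> -[k b1] [l b2] h.
  have kl : k = l.
    apply/eqP; apply: contraT => kl; have := trivIsetP tM _ _ (eeM k) (eeM l).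
    rewrite (inj_eq eeI) => /(_ kl); rewrite -setI_eq0 => /eqP/setP/(_ (f (k, b1))).
    by rewrite !inE fin h fin.
  rewrite -kl in h *; congr pair; move: h; rewrite !fE.
  by case: b1 b2 => -[] // /eqP; rewrite ?(negbTE (p1 k)) // eq_sym (negbTE (p1 k)).
- apply/eqP/setP=> u; apply/bigcupP/imsetP => /= [[e eM' ue]|[[k b'] _ ->]]; last first.
    by exists (ee k).
  have [k ke] : exists k, ee k = e.
    exists (cast_ord cM (enum_rank_in eM' e)).
    by rewrite /ee cast_ordK enum_rankK_in.
  move: ue; rewrite -ke p2 !inE => /orP[] /eqP->.
    by exists (k, false); rewrite ?inE // fE.
  by exists (k, true); rewrite ?inE // fE.
- apply/eqP/setP=> e; apply/idP/imsetP => /= [eM'|[e' /edges_matching[k ->] ->]]; last first.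
    by rewrite img.
  have [k ke] : exists k, ee k = e.
    exists (cast_ord cM (enum_rank_in eM' e)).
    by rewrite /ee cast_ordK enum_rankK_in.
  by exists [set ((k, false) : matching n); (k, true)]; rewrite ?matching_edge // img.
- apply/subsetP=> e /= /eM/existsP[x /existsP[y /and4P[_ xy _ /eqP->]]].
  exact: edge_complete.
Qed.

Lemma matching_copyP S : S \in copies (matching n) V ->
  [/\ trivIset S.2, cover S.2 = S.1, #|S.1| = n.*2
    & forall e, e \in S.2 -> exists x y, x != y /\ e = [set x; y]].
Proof.
rewrite inE => /existsP[f /and4P[/injectiveP fi /eqP e1 /eqP e2 sE]].
have img (k : 'I_n) : f @: [set ((k, false) : matching n); (k, true)] = [set f (k, false); f (k, true)].
  by rewrite imsetU1 imset_set1.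
have eS e : e \in S.2 -> exists k : 'I_n, e = [set f (k, false); f (k, true)].
  by rewrite e2 => /imsetP[e' /edges_matching[k ->] ->]; exists k; rewrite img.
split.
- apply/trivIsetP=> _ _ /eS[k ->] /eS[l ->] kl.
  have {}kl : k != l by apply: contraNneq kl => ->.
  rewrite -setI_eq0; apply/eqP/setP=> u; rewrite !inE; apply/negP=> /andP[/orP[] /eqP-> /orP[] /eqP/fi[/eqP]];
  by rewrite (negbTE kl).
- apply/setP=> u; rewrite e1; apply/bigcupP/imsetP => [[e /eS[k ->]]|[[k b] _ ->]].
    by rewrite !inE => /orP[] /eqP->; [exists (k, false)|exists (k, true)].
  exists [set f (k, false); f (k, true)]; last by case: b; rewrite !inE eqxx ?orbT.
  by rewrite e2 -img imset_f // matching_edge.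
- by rewrite e1 card_imset // cardsT card_prod card_ord card_bool muln2.
- move=> e /eS[k ->]; exists (f (k, false)), (f (k, true)); split=> //.
  by apply/eqP=> /fi.
Qed.

End MatchingCopies.

(** * Counting perfect matchings *)

Definition perfect_matchings (T : finType) (U : {set T}) : {set {set {set T}}} :=
  [set M | partition M U & [forall e in M, #|e| == 2]].

(** A fixed vertex of a set of 2k + 2 vertices has 2k + 1 possible partners, and the other edges
    match the remaining 2k vertices perfectly. *)
Lemma leq_perfect_matchings (T : finType) k (U : {set T}) :
  #|U| = k.*2 -> #|perfect_matchings U| <= odd_double_fact k.
Proof.
elim: k U => [|k IHk] U cU.
  rewrite /odd_double_fact big_ord0; have U0 : U = set0 by apply/eqP; rewrite -cards_eq0 cU.
  rewrite (leq_trans (subset_leq_card (_ : _ \subset [set set0]))) ?cards1 //.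
  apply/subsetP=> M; rewrite !inE U0 => /andP[hM _].
  by rewrite partition_set0 in hM.
have [x xU] : exists x, x \in U by apply/set0Pn; rewrite -card_gt0 cU.
rewrite /odd_double_fact big_ord_recr /= -/(odd_double_fact k).
have hp M : M \in perfect_matchings U ->
  exists2 y, y \in U :\ x & ([set x; y] \in M) && (M :\ [set x; y] \in perfect_matchings (U :\ x :\ y)).
  rewrite inE => /andP[pM /forall_inP h2].
  have xc : x \in cover M by rewrite (cover_partition pM).
  have eM : pblock M x \in M by rewrite pblock_mem.
  have := h2 _ eM.
  rewrite (cardsD1 x) mem_pblock xc eqSS => /cards1P[y ey].
  have exy : pblock M x = [set x; y].
    by rewrite -(setD1K (_ : x \in pblock M x)) ?mem_pblock // ey.
  have yx : y != x by have := set11 y; rewrite -ey !inE => /andP[].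
  have xyM : [set x; y] \in M by rewrite -exy.
  exists y.
    rewrite !inE yx -(cover_partition pM); apply/bigcupP; exists [set x; y] => //.
    by rewrite !inE eqxx orbT.
  rewrite xyM /= inE; apply/andP; split; last first.
    by apply/forall_inP=> e; rewrite inE => /andP[_ /h2].
  have -> : U :\ x :\ y = U :\: [set x; y] by rewrite setDDl.
  exact: partitionD1.
apply: (@leq_trans (\sum_(y in U :\ x) #|perfect_matchings (U :\ x :\ y)|)); last first.
  rewrite mulnC; have cUx : #|U :\ x| = 2 * k + 1.
    by have := cardsD1 x U; rewrite xU cU => ?; arith.
  rewrite -cUx -sum_nat_const; apply: leq_sum => y yU; apply: IHk.
  by have := cardsD1 y (U :\ x); rewrite yU cUx => ?; arith.
apply: (@leq_trans (\sum_(y in U :\ x) #|[set [set x; y] |: M | M in perfect_matchings (U :\ x :\ y)]|)); last first.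
  by apply: leq_sum => y _; apply: leq_imset_card.
apply: (@leq_trans #|\bigcup_(y in U :\ x) [set [set x; y] |: M | M in perfect_matchings (U :\ x :\ y)]|).
  apply: subset_leq_card; apply/subsetP=> M /hp[y yU /andP[xyM hM]].
  apply/bigcupP; exists y => //; apply/imsetP; exists (M :\ [set x; y]) => //.
  by rewrite setD1K.
elim/big_rec2: _ => [|y s B _ h]; first by rewrite cards0.
by apply: leq_trans (leq_card_setU _ _) _; rewrite leq_add2l.
Qed.

(** * Extremal colorings *)

Lemma two_other_colors (k : 'I_3) : exists i j : 'I_3,
  [/\ i != j, i != k, j != k & forall l, [|| l == i, l == j | l == k]].
Proof.
have [i [j [ij ik jk]]] : exists i j : 'I_3, [/\ i != j, i != k & j != k].
  case: k => [[|[|[|k]]] hk] //.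
  - by exists (inord 1), (inord 2); rewrite -!val_eqE /= !inordK.
  - by exists (inord 0), (inord 2); rewrite -!val_eqE /= !inordK.
  - by exists (inord 0), (inord 1); rewrite -!val_eqE /= !inordK.
exists i, j; split=> // l; apply: contraT; rewrite !negb_or => /and3P[li lj lk].
have : #|[set l; i; j; k]| <= 3 by rewrite -[leqRHS](card_ord 3) max_card.
rewrite -!setUA !cardsU1 !inE cards1 (negbTE li) (negbTE lj) (negbTE lk).
by rewrite (negbTE ij) (negbTE ik) (negbTE jk).
Qed.

Lemma card_interval N a b : #|[set x : 'I_N | a <= x < b]| <= b - a.
Proof.
rewrite cardE -(size_map val) -[leqRHS](size_iota a); apply: uniq_leq_size.
  by rewrite map_inj_uniq ?enum_uniq //; apply: val_inj.
move=> _ /mapP[x + ->]; rewrite mem_enum inE mem_iota => /andP[h1 h2].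
by rewrite h1 /= subnKC // (leq_trans h1) // ltnW.
Qed.

Section ClassColoring.

Variables (N n : nat) (cl : complete N -> 'I_3).
Local Notation V := (complete N).

(* The default [ord0] is never reached, since an edge meets at most two of the
   three classes; an edge between two classes gets the third color. *)
Definition class_coloring : coloring 3 N :=
  [ffun e : {set V} => odflt ord0 [pick i | i \notin [set cl x | x in e]]].

Lemma class_coloringP (x y : V) :
  class_coloring [set x; y] != cl x /\ class_coloring [set x; y] != cl y.
Proof.
rewrite ffunE imsetU1 imset_set1; case: pickP => [i|/= h].
  by rewrite !inE negb_or => /andP[].
have : #|[set: 'I_3]| <= #|[set cl x; cl y]|.
  by apply: subset_leq_card; apply/subsetP=> i _; have /negbFE := h i.
by rewrite cardsT card_ord cards2; case: (_ != _).
Qed.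

Lemma class_coloring_rainbow : rainbow_copies class_coloring star3 = set0.
Proof.
apply/setP=> S; rewrite [RHS]inE; apply/negP=> /rainbow_starP[v hv].
have [x _ hx] := hv (cl v); have [] := class_coloringP v x.
by rewrite -/(col class_coloring v x) hx eqxx.
Qed.

Lemma class_coloring_exact : (forall i, exists x, cl x = i) -> exact class_coloring.
Proof.
move=> hcl i; have [j [k [jk _ _ all3]]] := two_other_colors i.
have [x hx] := hcl j; have [y hy] := hcl k.
have xy : x != y by apply: contraNneq jk => exy; rewrite -hx -hy exy.
exists [set x; y]; first exact: edge_complete.
have [] := class_coloringP x y; rewrite hx hy => tj tk.
by have := all3 (class_coloring [set x; y]); rewrite (negbTE tj) (negbTE tk) => /eqP.
Qed.

(** No edge at a vertex of class [i] has color [i], so a matching of this color lives on the two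
    other classes. *)
Lemma class_coloring_mono S : 0 < n ->
  S \in mono_copies class_coloring (matching n) ->
  exists2 i, S.1 \subset [set x | cl x != i] & #|S.1| = n.*2.
Proof.
move=> n0; rewrite inE => /andP[/matching_copyP[tS cS nS eS] /forall_inP hm].
have [e eM] : exists e, e \in S.2.
  apply/set0Pn; apply/eqP=> S0; move: nS; rewrite -cS S0 /cover big_set0 cards0.
  by move=> h; move: n0; rewrite -double_gt0 -h.
exists (class_coloring e) => //; apply/subsetP=> x; rewrite -cS => /bigcupP[f fM xf].
have /forall_inP/(_ f fM)/eqP -> := hm e eM.
have [y [z [_ ef]]] := eS f fM; rewrite ef in xf *; rewrite inE eq_sym.
have [h1 h2] := class_coloringP y z.
by move: xf; rewrite !inE => /orP[] /eqP->.
Qed.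

End ClassColoring.

Section Intervals.

Variables (N t1 t2 : nat).
Hypotheses (h1 : 0 < t1) (h12 : t1 < t2) (h2 : t2 < N).

Definition interval_class (x : complete N) : 'I_3 :=
  if (x : 'I_N) < t1 then inord 0 else if (x : 'I_N) < t2 then inord 1 else inord 2.

Lemma interval_class_onto i : exists x, interval_class x = i.
Proof.
have k0 : 0 < N by apply: leq_trans h2.
have k1 : t1 < N by apply: ltn_trans h2.
case: i => [[|[|[|i]]] hi] //.
- by exists (Ordinal k0); rewrite /interval_class /= h1; apply: val_inj; rewrite /= inordK.
- by exists (Ordinal k1); rewrite /interval_class /= ltnn h12; apply: val_inj; rewrite /= inordK.
- exists (Ordinal h2); rewrite /interval_class /= ltnn ltnNge (ltnW h12) /=.
  by apply: val_inj; rewrite /= inordK.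
Qed.

Lemma interval_class_neq0 : #|[set x | interval_class x != inord 0]| <= N - t1.
Proof.
apply: leq_trans (card_interval N t1 N); apply: subset_leq_card; apply/subsetP=> x.
by rewrite !inE ltn_ord andbT /interval_class; case: ltnP => //; rewrite eqxx.
Qed.

Lemma interval_class_neq1 : #|[set x | interval_class x != inord 1]| <= t1 + (N - t2).
Proof.
apply: leq_trans (_ : #|[set x : 'I_N | 0 <= x < t1] :|: [set x : 'I_N | t2 <= x < N]| <= _).
  apply: subset_leq_card; apply/subsetP=> x; rewrite !inE ltn_ord andbT /= /interval_class.
  by case: (ltnP x t1) => //= _; case: ltnP => //; rewrite eqxx.
apply: leq_trans (leq_card_setU _ _) _; apply: leq_add; last exact: card_interval.
by rewrite -[leqRHS]subn0; apply: card_interval.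
Qed.

Lemma interval_class_neq2 : #|[set x | interval_class x != inord 2]| <= t2.
Proof.
rewrite -[leqRHS]subn0; apply: leq_trans (card_interval N 0 t2); apply: subset_leq_card.
apply/subsetP=> x; rewrite !inE /= /interval_class.
case: (ltnP x t1) => [h _|_]; first by apply: ltn_trans h12.
by case: ltnP => //; rewrite eqxx.
Qed.

Lemma ord3_cases (i : 'I_3) : [\/ i = inord 0, i = inord 1 | i = inord 2].
Proof.
case: i => [[|[|[|i]]] hi] //; [apply: Or31|apply: Or32|apply: Or33];
by apply: val_inj; rewrite /= inordK.
Qed.

End Intervals.

(* Class sizes n - 1, n - 1, n: any two classes have at most 2n - 1 vertices. *)
Lemma gr_lower n m : 2 <= n -> gr_bound 3 star3 (matching n) m -> 3 * n - 1 <= m.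
Proof.
move=> hn [_ hm]; rewrite leqNgt; apply/negP=> mlt.
have hN : m <= 3 * n - 2 by arith.
have [t1 [t2 [ht1 ht2 h1 h12 h2]]] :
    exists t1 t2, [/\ t1 = n - 1, t2 = 2 * n - 2, 0 < t1, t1 < t2 & t2 < 3 * n - 2].
  by exists (n - 1), (2 * n - 2); split=> //; arith.
pose c := class_coloring (@interval_class (3 * n - 2) t1 t2).
have ce : exact c by apply/class_coloring_exact/interval_class_onto.
case: (hm _ hN c ce) => [[S]|[S hS]].
  by rewrite class_coloring_rainbow inE.
have [|i sS cS] := class_coloring_mono _ hS; first by arith.
have := subset_leq_card sS; rewrite cS.
have n0 := @interval_class_neq0 (3 * n - 2) t1 t2.
have n1 := @interval_class_neq1 (3 * n - 2) t1 t2.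
have n2 := @interval_class_neq2 (3 * n - 2) t1 t2 h12.
by case: (ord3_cases i) => -> h; arith.
Qed.

(* Class sizes n - 1, n, n: only the last two classes together have 2n vertices. *)
Lemma GM_upper n : 2 <= n ->
  exists2 c : coloring 3 (3 * n - 1), exact c &
    #|rainbow_copies c star3| + #|mono_copies c (matching n)| <= odd_double_fact n.
Proof.
move=> hn.
have [t1 [t2 [ht1 ht2 h1 h12 h2]]] :
    exists t1 t2, [/\ t1 = n - 1, t2 = 2 * n - 1, 0 < t1, t1 < t2 & t2 < 3 * n - 1].
  by exists (n - 1), (2 * n - 1); split=> //; arith.
pose cl := @interval_class (3 * n - 1) t1 t2; pose c := class_coloring cl.
exists c; first by apply/class_coloring_exact/interval_class_onto.
rewrite class_coloring_rainbow cards0 add0n.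
pose U := [set x | cl x != inord 0].
have n0 := @interval_class_neq0 (3 * n - 1) t1 t2; rewrite -/cl -/U in n0.
have n1 := @interval_class_neq1 (3 * n - 1) t1 t2.
have n2 := @interval_class_neq2 (3 * n - 1) t1 t2 h12.
rewrite -/cl in n1 n2.
(* Any other pair of classes has at most 2n - 1 vertices, and [U] has at most 2n, so a copy covers
   [U] exactly. *)
have hU S : S \in mono_copies c (matching n) -> S.1 = U /\ #|U| = n.*2.
  move=> hS; have [|i sS cS] := class_coloring_mono _ hS; first by arith.
  have := subset_leq_card sS; rewrite cS.
  case: (ord3_cases i) sS => -> sS h; [|exfalso; arith|exfalso; arith].
  rewrite -/cl -/U in sS h; have cU : #|U| = n.*2 by arith.
  split=> //; apply/eqP; rewrite eqEcard sS /= cS cU; exact: leqnn.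
have [S0 hS0|h0] := pickP (mem (mono_copies c (matching n))); last first.
  by rewrite (eq_card0 h0).
have [_ cU] := hU S0 hS0.
apply: leq_trans (leq_perfect_matchings cU).
rewrite -(card_in_imset (f := snd) (D := mem (mono_copies c (matching n)))); last first.
  move=> [S1 S2] [T1 T2] hS hT /= e2.
  have [/= e1 _] := hU _ hS; have [/= e1' _] := hU _ hT.
  by rewrite e1 e1' e2.
apply: subset_leq_card; apply/subsetP=> M /imsetP[S hS ->].
have [e1 _] := hU S hS; move: (hS); rewrite inE => /andP[/matching_copyP[tS cS _ eS] _].
rewrite inE; apply/andP; split; last first.
  by apply/forall_inP=> e /eS[x [y [xy ->]]]; rewrite cards2 xy.
rewrite /partition cS e1 eqxx tS /=; apply/negP=> /eS[x [y [_ /setP/(_ x)]]].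
by rewrite !inE eqxx.
Qed.

(** * The lower bound *)

Lemma bigmin_leq (T : eqType) (s : seq T) (F : T -> nat) x0 i :
  i \in s -> \big[minn/x0]_(j <- s) F j <= F i.
Proof.
elim: s => // a s IHs; rewrite inE big_cons => /orP[/eqP->|/IHs h]; first exact: geq_minl.
exact: leq_trans (geq_minr _ _) h.
Qed.

Lemma lower_bound_leq n r : r <= 4 * n - 2 -> lower_bound n <= lower_term n r.
Proof. by move=> hr; apply: bigmin_leq; rewrite mem_index_iota /= ltnS. Qed.

(** For r = n - 6 the rounded quotient is n + 1, so the binomial coefficient is only n + 1. *)
Lemma lower_bound_quadratic n : 6 <= n -> lower_bound n <= (n - 6) * (4 * n - 5) + n + 1.
Proof.
move=> hn; apply: leq_trans (@lower_bound_leq n (n - 6) _) _; first by arith.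
rewrite /lower_term; have -> : (4 * n - 1 - (n - 6)) %/ 3 = n.+1.
  have -> : 4 * n - 1 - (n - 6) = n.+1 * 3 + 2 by arith.
  by rewrite divnMDl // addn0.
by rewrite binSn; arith.
Qed.

Lemma lower_bound_small n : 2 <= n <= 6 -> lower_bound n <= (n - 1) ^_ (n - 2).
Proof.
move=> hn; apply: leq_trans (@lower_bound_leq n 0 _) _ => //.
have : n \in [:: 2; 3; 4; 5; 6] by rewrite !inE; clear -hn; lia.
by rewrite !inE => /or4P[/eqP->|/eqP->|/eqP->|/orP[]/eqP->]; vm_compute.
Qed.

Lemma lower_bound_small_star n : 2 <= n <= 6 -> lower_bound n <= 3 * n - 4.
Proof.
move=> hn; apply: leq_trans (@lower_bound_leq n 0 _) _ => //.
have : n \in [:: 2; 3; 4; 5; 6] by rewrite !inE; clear -hn; lia.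
by rewrite !inE => /or4P[/eqP->|/eqP->|/eqP->|/orP[]/eqP->]; vm_compute.
Qed.

(** * The number of rainbow stars at a vertex with color degrees x, y, z *)

Lemma mul_ge_pred x y : 0 < x -> 0 < y -> x + y <= x * y + 1.
Proof. by move=> x0 y0; nia. Qed.

(** The product is smallest for the degrees 1, 1, 3n - 4. *)
Lemma star_cost n x y z : 0 < x -> 0 < y -> 0 < z -> x + y + z = 3 * n - 2 ->
  3 * n - 4 <= x * y * z.
Proof.
move=> x0 y0 z0 hs; have h1 := mul_ge_pred x0 y0.
have xy0 : 0 < x * y by rewrite muln_gt0 x0.
have h2 := mul_ge_pred xy0 z0.
by move: (x * y) (x * y * z) h1 h2 => p q h1 h2; arith.
Qed.

(** If y is the smaller of x and y, the product is at least y(3n - 3 - y), where 2y <= 3n - 3. For y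
    < n the second factor is at least 2n - 2; beyond that the quadratic keeps at least its value at
    n - 1. *)
Lemma star_cost_mixed n x y z t : 2 <= n -> 0 < x -> 0 < y -> 0 < z ->
  x + y + z = 3 * n - 2 -> t <= x -> t <= y -> t <= n - 1 ->
  (2 * n - 2) * t <= x * y * z.
Proof.
move=> n2; wlog hxy : x y / y <= x => [hw|] x0 y0 z0 hs tx ty tn.
  case: (leqP y x) => h; first exact: hw.
  by rewrite [x * y]mulnC; apply: hw => //; [exact: ltnW|rewrite (addnC y)].
have h1 : x + z <= x * z + 1 by apply: mul_ge_pred.
have h2 : y * (3 * n - 3 - y) <= x * y * z.
  by rewrite -mulnA mulnCA leq_mul2l; apply/orP; right; arith.
apply: leq_trans h2; have h3 : y.*2 <= 3 * n - 3 by arith.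
case: (leqP y (n - 1)) => hy.
  by rewrite mulnC; apply: leq_mul => //; arith.
apply: (@leq_trans ((2 * n - 2) * (n - 1))); first by rewrite leq_mul2l tn orbT.
have [u eu] : exists u, y = n + u by exists (y - n); arith.
have [q eq] : exists q, 3 * n - 3 = (n + u).*2 + q by exists (3 * n - 3 - (n + u).*2); arith.
have -> : 3 * n - 3 - y = n + u + q by arith.
have en : n = u.*2 + q + 3 by arith.
by subst; clear; nia.
Qed.

(** Once 1, 1, 3n - 4 is excluded, the cheapest degrees are 1, 2, 3n - 5. *)
Lemma star_cost_far n x y z : 2 <= n -> 0 < x -> 0 < y -> 0 < z ->
  x + y + z = 3 * n - 2 -> x != 3 * n - 4 -> y != 3 * n - 4 -> z != 3 * n - 4 ->
  6 * n - 10 <= x * y * z.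
Proof.
move=> n2.
wlog hz : x y z / (x <= z) && (y <= z) => [hw|].
  move=> x0 y0 z0 hs hx hy hz'.
  case: (leqP x z) => xz; case: (leqP y z) => yz.
  - by apply: hw => //; rewrite xz yz.
  - rewrite -mulnA [y * z]mulnC mulnA; apply: hw => //; arith.
  - have -> : x * y * z = z * y * x by rewrite mulnC [x * y]mulnC mulnA.
    apply: hw => //; arith.
  - case: (leqP x y) => xy.
      rewrite -mulnA [y * z]mulnC mulnA; apply: hw => //; arith.
    have -> : x * y * z = z * y * x by rewrite mulnC [x * y]mulnC mulnA.
    apply: hw => //; arith.
case/andP: hz => xz yz x0 y0 z0 hs _ _ hz.
have hxy : 3 <= x + y.
  by rewrite ltnNge; apply/negP=> h; case/eqP: hz; arith.
have h1 := mul_ge_pred x0 y0.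
have h2 : 3 * z + 2 >= 3 * n by arith.
apply: (@leq_trans ((x + y - 1) * z)); last by rewrite leq_mul2r; apply/orP; right; arith.
have [s es] : exists s, x + y = s + 3 by exists (x + y - 3); arith.
have -> : x + y - 1 = s + 2 by arith.
have ez : z + s + 5 = 3 * n by arith.
by clear -h2 ez; nia.
Qed.

(** With z the largest, the product is at least (x + y - 1)z. This is smallest when x + y = n + 1 -
    r, where the factors are n - r and 2n - 3 + r. *)
Lemma star_cost_pairs n r x y z : 0 < x -> 0 < y -> 0 < z -> x + y + z = 3 * n - 2 ->
  2 <= r -> r + 4 <= n ->
  n + 1 - r <= x + y -> n + 1 - r <= x + z -> n + 1 - r <= y + z ->
  (n - r) * (2 * n - 1) <= x * y * z.
Proof.
move=> + + + + r2 rn.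
wlog hz : x y z / (x <= z) && (y <= z) => [hw|].
  move=> x0 y0 z0 hs h1 h2 h3.
  case: (leqP x z) => xz; case: (leqP y z) => yz.
  - by apply: hw => //; rewrite xz yz.
  - rewrite -mulnA [y * z]mulnC mulnA; apply: hw => //; arith.
  - have -> : x * y * z = z * y * x by rewrite mulnC [x * y]mulnC mulnA.
    apply: hw => //; arith.
  - case: (leqP x y) => xy.
      rewrite -mulnA [y * z]mulnC mulnA; apply: hw => //; arith.
    have -> : x * y * z = z * y * x by rewrite mulnC [x * y]mulnC mulnA.
    apply: hw => //; arith.
case/andP: hz => xz yz x0 y0 z0 hs hxy _ _.
have h1 := mul_ge_pred x0 y0.
have h2 : 3 * z + 2 >= 3 * n by arith.
apply: (@leq_trans ((x + y - 1) * z)); last by rewrite leq_mul2r; apply/orP; right; arith.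
have [s es] : exists s, x + y = s + (n + 1 - r) by exists (x + y - (n + 1 - r)); arith.
have [t et] : exists t, n = r + 4 + t by exists (n - r - 4); arith.
have [q eq] : exists q, r = q + 2 by exists (r - 2); arith.
have e1 : n - r = t + 4 by arith.
have e2 : x + y - 1 = s + (t + 4) by arith.
have e3 : z + s + 3 + t + 4 = 3 * n by arith.
rewrite e1 e2; clear -h2 e3 et eq; subst; nia.
Qed.

Lemma ffact3 n : n ^_ 3 = n * (n - 1) * (n - 2).
Proof. by rewrite !ffactnSr ffactn0 mul1n subn0. Qed.

Lemma leq_ffactr n k k' : k <= k' -> k' <= n -> n ^_ k <= n ^_ k'.
Proof.
elim: k' => [|k' IHk']; first by rewrite leqn0 => /eqP->.
rewrite leq_eqVlt => /orP[/eqP->//|]; rewrite ltnS => kk' kn.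
apply: leq_trans (IHk' kk' (ltnW kn)) _.
by rewrite ffactnSr leq_pmulr // subn_gt0.
Qed.

Lemma quadratic_leq_ffact2 n : 7 <= n -> (n - 6) * (4 * n - 5) + n + 1 <= (n - 2) ^_ 3.
Proof.
move=> n7; have [t ->] : exists t, n = t + 7 by exists (n - 7); arith.
rewrite ffact3; have -> : t + 7 - 2 = t + 5 by arith.
have -> : t + 7 - 6 = t + 1 by arith.
have -> : 4 * (t + 7) - 5 = 4 * t + 23 by arith.
have -> : t + 5 - 1 = t + 4 by arith.
have -> : t + 5 - 2 = t + 3 by arith.
by clear; nia.
Qed.

Lemma quadratic_leq_ffact3 n : 14 <= n -> (n - 6) * (4 * n - 5) + n + 1 <= (n - 3) ^_ 3.
Proof.
move=> n14; have [t ->] : exists t, n = t + 14 by exists (n - 14); arith.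
rewrite ffact3; have -> : t + 14 - 3 = t + 11 by arith.
have -> : t + 14 - 6 = t + 8 by arith.
have -> : 4 * (t + 14) - 5 = 4 * t + 51 by arith.
have -> : t + 11 - 1 = t + 10 by arith.
have -> : t + 11 - 2 = t + 9 by arith.
by clear; nia.
Qed.

(** So n - 3 trichromatic vertices, at 3n - 4 stars each, can stay below the target only when n is
    at least 14. *)
Lemma quadratic_gt n : 7 <= n -> (n - 3) * (3 * n - 4) < (n - 6) * (4 * n - 5) + n + 1 ->
  14 <= n.
Proof.
move=> n7 h; rewrite leqNgt; apply/negP=> hn; move: h.
have : n \in [:: 7; 8; 9; 10; 11; 12; 13] by rewrite !inE; clear -n7 hn; lia.
by rewrite !inE; do !case/orP; move=> /eqP->.
Qed.

(** * Classes avoiding a color, and trichromatic vertices *)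

Section Coloring.

Variables (N : nat) (c : coloring 3 N).
Local Notation V := (complete N).

Implicit Types (v x y z : V) (i j k l : 'I_3) (W : {set V}).

Definition avoiding k : {set V} := [set v | color_nbr c v k == set0].

Definition trichromatic : {set V} := [set v | [forall k, color_nbr c v k != set0]].

Lemma avoidingP k v x : v \in avoiding k -> x != v -> col c v x != k.
Proof.
rewrite inE => /eqP/setP/(_ x) h xv; move: h.
by rewrite !inE xv /= => /negbT.
Qed.

Section Triple.

Variables (i j k : 'I_3).
Hypotheses (ij : i != j) (ik : i != k) (jk : j != k)
  (all3 : forall l, [|| l == i, l == j | l == k]).

Lemma big3 (R : Type) (idx : R) (op : Monoid.com_law idx) (F : 'I_3 -> R) :
  \big[op/idx]_l F l = op (F i) (op (F j) (F k)).
Proof.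
rewrite (bigD1 i) //= (bigD1 j) 1?eq_sym //= (bigD1 k) /=; last first.
  by rewrite ![k == _]eq_sym ik jk.
rewrite big1 ?Monoid.mulm1 // => l /andP[/andP[li lj] lk].
by have := all3 l; rewrite (negbTE li) (negbTE lj) (negbTE lk).
Qed.

Lemma color_nbr_sum v : #|color_nbr c v i| + #|color_nbr c v j| + #|color_nbr c v k| = N.-1.
Proof.
rewrite -[RHS](_ : #|[set~ v]| = _); last by rewrite cardsC1 card_ord.
rewrite -[RHS]sum1_card [RHS](partition_big (col c v) predT) //= big3 /= -addnA.
by congr (_ + (_ + _)); rewrite sum1dep_card; apply: eq_card => x; rewrite !inE.
Qed.

Lemma avoiding_deg v : v \notin avoiding k ->
  #|avoiding k| <= #|color_nbr c v i| + #|color_nbr c v j|.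
Proof.
move=> vN; apply: leq_trans (leq_card_setU _ _); apply: subset_leq_card.
apply/subsetP=> x xN; have xv : x != v by apply: contraNneq vN => <-.
have := avoidingP xN (_ : v != x); rewrite eq_sym xv col_sym => /(_ isT) nk.
by rewrite !inE xv /=; have := all3 (col c v x); rewrite (negbTE nk) orbF.
Qed.

Lemma trichromatic_cover W :
  W \subset trichromatic :|: (avoiding i :|: (avoiding j :|: avoiding k)).
Proof.
apply/subsetP=> v _; rewrite inE; case: (boolP (v \in trichromatic)) => //=.
rewrite inE negb_forall => /existsP[l]; rewrite negbK => hl.
have vl : v \in avoiding l by rewrite inE.
by rewrite 2!in_setU; have := all3 l; case/or3P => /eqP<-; rewrite vl ?orbT.
Qed.

Let A := avoiding k.
Let g : rel V := fun x y => col c x y == i.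

Lemma col_rel_sym : symmetric g.
Proof. by move=> x y; rewrite /g col_sym. Qed.

Lemma centric_col b e : medge A g b e -> c e = if b then i else j.
Proof.
case/existsP=> x /existsP[y /and4P[xA xy /eqP gb /eqP->]].
rewrite -/(col c x y); move: gb; rewrite /g; have := all3 (col c x y).
have nk : col c x y != k by apply: avoidingP xA _; rewrite eq_sym.
by rewrite (negbTE nk) orbF; case: eqP => [-> _ <-|_ /= /eqP-> <-].
Qed.

Lemma num_matchings_leq_mono W n :
  0 < n -> num_matchings A g W n <= #|mono_copies c (matching n)|.
Proof.
move=> n0.
have h b M : M \in matchings A g b W n -> (cover M, M) \in mono_copies c (matching n).
  by move=> hM; apply: (mono_copy_matchings hM (i := if b then i else j)); apply: centric_col.
have dis : [disjoint matchings A g true W n & matchings A g false W n].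
  rewrite -setI_eq0; apply/eqP/setP=> M; rewrite in_set0; apply/negP.
  case/setIP=> /matchingsP[cM _ _ eT] /matchingsP[_ _ _ eF].
  have /set0Pn[e eM] : M != set0 by rewrite -card_gt0 cM.
  by have := centric_col (eT e eM); rewrite (centric_col (eF e eM)) => /eqP; rewrite eq_sym (negbTE ij).
rewrite /num_matchings -cardsUI (disjoint_setI0 dis) cards0 addn0.
rewrite -(card_imset _ (_ : injective (fun M => (cover M, M)))); last by move=> M M' [].
apply: subset_leq_card; apply/subsetP=> _ /imsetP[M + ->].
by rewrite inE => /orP[]; apply: h.
Qed.

(** Such a [z] avoids [i] or [j], and its edges to [A] avoid [k], so these all have the same
    color. *)
Lemma minority_avoiding W z : z \notin A -> z \notin trichromatic -> minority A g W z = 0.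
Proof.
move=> zA zR; apply/eqP; rewrite -leqn0 /minority geq_min !leqn0 !cards_eq0.
have xz x : x \in A -> x != z by apply: contraTneq => ->.
have : (z \in avoiding i) || (z \in avoiding j).
  have := subsetP (trichromatic_cover setT) z (in_setT z).
  by rewrite !in_setU (negbTE zR) -/A (negbTE zA) orbF.
case/orP=> hz; apply/orP; [left|right]; apply/eqP/setP=> x; rewrite in_set0 in_set in_setI /g; apply/negP.
  by case/andP=> /andP[xA _]; rewrite (negbTE (avoidingP hz (xz x xA))).
case/andP=> /andP[xA _]; have nz := xz x xA.
have h1 := avoidingP hz nz; have := avoidingP xA (_ : z != x); rewrite eq_sym nz col_sym => /(_ isT) h2.
by have := all3 (col c z x); rewrite (negbTE h1) (negbTE h2) !orbF => ->.
Qed.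

Lemma minority_leq_deg W z : z \notin A ->
  minority A g W z <= #|color_nbr c z i| /\ minority A g W z <= #|color_nbr c z j|.
Proof.
move=> zA; have xz x : x \in A -> x != z by apply: contraTneq => ->.
split; [apply: leq_trans (geq_minl _ _) _|apply: leq_trans (geq_minr _ _) _];
  apply: subset_leq_card; apply/subsetP=> x; rewrite in_set in_setI /g => /andP[/andP[xA _]].
  by move=> /eqP h; rewrite in_set (xz x) // h.
have nz := xz x xA; rewrite in_set nz /= => /eqP h.
have := avoidingP xA (_ : z != x); rewrite eq_sym nz col_sym => /(_ isT) h2.
by have := all3 (col c z x); rewrite h (negbTE h2) orbF.
Qed.

Lemma cost_triple : \sum_(v : V) #|color_nbr c v i| * #|color_nbr c v j| * #|color_nbr c v k|
  <= #|rainbow_copies c star3|.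
Proof.
apply: leq_trans (leq_rainbow c); apply: leq_sum => v _.
have -> : #|color_nbr c v i| * #|color_nbr c v j| * #|color_nbr c v k| = \prod_l #|color_nbr c v l|.
  by rewrite big3 /= mulnA.
rewrite (big_ord_recl 2) (big_ord_recl 1) (big_ord_recl 0) big_ord0 muln1 mulnA.
apply/eq_leq; congr (_ * _ * _); congr #|pred_of_set (color_nbr c v _)|;
  by apply: val_inj; rewrite /= inordK.
Qed.

End Triple.

End Coloring.

(** Without trichromatic vertices the three classes cover the 3n - 1 vertices of [W], so a largest
    one has at least n of them. All defects vanish, and the count can run down to m0 = 2. The set
    [W] may be proper, since the Gallai-Ramsey number concerns larger complete graphs too. *)
Lemma mono_pure N (c : coloring 3 N) n (W : {set complete N}) : 2 <= n ->
  #|W|.+1 = 3 * n -> trichromatic c = set0 ->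
  (n - 1) ^_ (n - 2) <= #|mono_copies c (matching n)|.
Proof.
move=> n2 cW R0.
pose k := [arg max_(k > ord0 : 'I_3) #|avoiding c k :&: W|].
have kmax l : #|avoiding c l :&: W| <= #|avoiding c k :&: W|.
  by rewrite /k; case: arg_maxnP => // i _; apply.
have [i [j [ij ik jk all3]]] := two_other_colors k.
have ha : n <= #|avoiding c k :&: W|.
  have : #|W| <= #|avoiding c i :&: W| + (#|avoiding c j :&: W| + #|avoiding c k :&: W|).
    apply: leq_trans (leq_add (leqnn _) (leq_card_setU _ _)).
    apply: leq_trans (leq_card_setU _ _); apply: subset_leq_card.
    rewrite -!setIUl subsetI subxx andbT.
    by have := trichromatic_cover c all3 W; rewrite R0 set0U.
  by have := kmax i; have := kmax j => ? ? ?; arith.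
apply: leq_trans (@num_matchings_leq_mono N c i j k ij all3 W n _); last by arith.
have := @num_matchings_engine (complete N) (avoiding c k) (fun x y => col c x y == i) (col_rel_sym c i)
  n 2 (n - 2) 0 0 (fun=> 0) W.
rewrite big1 // subnKC // !subn0; apply => //; first by move=> W' _ z zA; rewrite (minority_avoiding all3) // R0 inE.
- rewrite (_ : [set _ in _ | _] = set0) ?cards0 //.
  by apply/setP=> z; rewrite !inE ltnn andbF.
- by rewrite addn0.
Qed.

(** * The lower bound for n at least 7 *)

Section Main.

Variables (n N : nat) (c : coloring 3 N).
Hypotheses (n7 : 7 <= n) (hN : N.+1 = 3 * n).
Local Notation V := (complete N).
Local Notation stars := #|rainbow_copies c star3|.
Local Notation monos := #|mono_copies c (matching n)|.
Local Notation d v i := #|color_nbr c v i|.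
Local Notation R := (trichromatic c).
Local Notation U := ((n - 6) * (4 * n - 5) + n + 1).

Section Colors.

Variables (i j k : 'I_3).
Hypotheses (ij : i != j) (ik : i != k) (jk : j != k)
  (all3 : forall l, [|| l == i, l == j | l == k]).

Lemma deg_sum3 v : d v i + d v j + d v k = 3 * n - 2.
Proof. by rewrite (color_nbr_sum c ij ik jk all3) -hN; arith. Qed.

Lemma tri_pos v l : v \in R -> 0 < d v l.
Proof. by rewrite inE => /forallP/(_ l); rewrite card_gt0. Qed.

Lemma cost_sum (X : {set V}) (f : V -> nat) :
  (forall v, v \in X -> f v <= d v i * d v j * d v k) -> \sum_(v in X) f v <= stars.
Proof.
move=> h; apply: leq_trans (cost_triple c ij ik jk all3).
rewrite big_mkcond /=; apply: leq_sum => v _.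
by case: ifP => // /h.
Qed.

Lemma tri_cost : #|R| * (3 * n - 4) <= stars.
Proof.
rewrite -sum_nat_const; apply: cost_sum => v vR.
by apply: star_cost; rewrite ?tri_pos // deg_sum3.
Qed.

Lemma avoiding_tri l v : v \in R -> v \notin avoiding c l.
Proof. by move=> vR; rewrite inE; have := tri_pos l vR; rewrite card_gt0. Qed.

(** The cap n - 1 is required by [star_cost_mixed]. It is harmless for the count, which uses [w]
    only when fewer than 2n class vertices are present, and then a minority is at most n - 1. *)
Let w z := minn (minority (avoiding c k) (fun x y => col c x y == i) setT z) (n - 1).

(** Every unit of defect costs 2n - 2 stars, so the total defect is at most 2n - 9. This is just
    what the count admits for m0 = n - 3 and e = 1; its three steps give a falling factorial of
    length 3. *)
Lemma engine_main dd : dd <= 1 -> stars < U ->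
  (dd == 1) || (#|R| < n - 3) -> n + dd <= #|avoiding c k| ->
  (n - dd - 2) ^_ 3 <= monos.
Proof.
move=> hd hrs hmix ha.
apply: leq_trans (@num_matchings_leq_mono N c i j k ij all3 setT n _); last by clear -n7; lia.
have wR z : z \notin avoiding c k -> 0 < w z -> z \in R.
  move=> zA; apply: contraTT => zR; rewrite -leqNgt leqn0.
  by rewrite /w (minority_avoiding all3) // min0n.
have hw : (2 * n - 2) * \sum_(z in ~: avoiding c k) w z <= stars.
  rewrite big_distrr /=; apply: cost_sum => z; rewrite in_setC => zA.
  case: (posnP (w z)) => [->|w0]; first by rewrite muln0.
  have zR := wR z zA w0.
  have [m1 m2] := minority_leq_deg all3 setT zA.
  apply: star_cost_mixed; rewrite ?tri_pos ?deg_sum3 //.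
  - by clear -n7; lia.
  - exact: leq_trans (geq_minl _ _) m1.
  - exact: leq_trans (geq_minl _ _) m2.
  - exact: geq_minr.
have hs : \sum_(z in ~: avoiding c k) w z <= 2 * n - 9.
  move: (\sum_(z in _) _) hw => s hw; rewrite leqNgt; apply/negP=> hs'.
  have : (2 * n - 2) * (2 * n - 8) <= (2 * n - 2) * s by rewrite leq_mul2l; apply/orP; right; arith.
  have [t et] : exists t, n = t + 7 by exists (n - 7); arith.
  move: hw hrs; set q := stars; clearbody q; clear -et n7 => h1 h2 h3.
  have {h1 h3}: (2 * n - 2) * (2 * n - 8) < U by apply: leq_ltn_trans h2; apply: leq_trans h1.
  by rewrite et; clear; nia.
have := @num_matchings_engine V (avoiding c k) (fun x y => col c x y == i) (col_rel_sym c i)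
  n (n - 3) 3 dd 1 w setT hd.
have e1 : n - 3 + 3 = n by clear -n7; lia.
rewrite e1 setIT cardsT card_ord; have -> : n - dd - 1 - 1 = n - dd - 2 by clear; lia.
apply => //.
- move=> W hW z zA; rewrite /w leq_min; apply/andP; split.
    rewrite /minority leq_min; apply/andP; split; first by apply: leq_trans (geq_minl _ _) _; apply/deg_mono/subsetT.
    by apply: leq_trans (geq_minr _ _) _; apply/deg_mono/subsetT.
  have half a b m : a + b = m -> m < n.*2 -> minn a b <= n - 1 by clear; lia.
  exact: half (deg_sum (avoiding c k) (fun x y => col c x y == i) true W z) hW.
- by arith.
- by arith.
- case/orP: hmix => [->//|h]; apply/orP; right; apply: leq_ltn_trans h.
  apply: subset_leq_card; apply/subsetP=> z; rewrite in_set in_setC => /andP[]; exact: wR.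
- by apply/orP; right; clear -n7; lia.
Qed.

End Colors.

(** Each vertex avoiding [l] is joined to [v] by one of the only two edges at [v] of another
    color. *)
Lemma near_mono_avoiding l v : v \in R -> d v l = 3 * n - 4 -> #|avoiding c l| <= 2.
Proof.
move=> vR dl; have [i [j [ij ik jk all3]]] := two_other_colors l.
apply: leq_trans (avoiding_deg all3 (avoiding_tri l vR)) _.
by have := deg_sum3 ij ik jk all3 v; rewrite dl => ?; arith.
Qed.

(* The vertices with all but two edges in one color: by cost they are at least two
   thirds of n, and they all share the same color k because a class avoiding k
   has at most two vertices. *)
Lemma near_mono_main : stars < U -> n - 3 <= #|R| ->
  (forall l, #|avoiding c l| <= n) -> U <= monos.
Proof.
move=> hrs hR hN'.
pose P := [set v in R | [exists l, d v l == 3 * n - 4]].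
have sPR : P \subset R by apply/subsetP=> v; rewrite in_set => /andP[].
have [i0 [j0 [ij0 ik0 jk0 all30]]] := two_other_colors ord0.
have r1 := tri_cost ij0 ik0 jk0 all30.
have cR : #|P| + #|R :\: P| = #|R| by rewrite -(cardsID P R) (setIidPr sPR).
have cost : #|P| * (3 * n - 4) + #|R :\: P| * (6 * n - 10) <= stars.
  apply: leq_trans (cost_sum ij0 ik0 jk0 all30 (X := R)
    (f := fun v => if v \in P then 3 * n - 4 else 6 * n - 10) _).
    rewrite (big_setID P) /= (setIidPr sPR); apply: leq_add.
      by rewrite -sum_nat_const; apply: leq_sum => v ->.
    by rewrite -sum_nat_const; apply: leq_sum => v /setDP[_ /negbTE->].
  move=> v vR; have hs := deg_sum3 ij0 ik0 jk0 all30 v.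
  case: ifP => [_|/negbT]; first by apply: star_cost; rewrite ?tri_pos.
  rewrite in_set vR negb_exists => /forallP hv.
  by apply: star_cost_far; rewrite ?tri_pos ?hv //; clear -n7; lia.
(* The last two bounds yield 2p - r > 10, which makes [K] below large enough. *)
have arith1 (r p q u : nat) : u < U -> n - 3 <= r -> p + q = r ->
    p * (3 * n - 4) + q * (6 * n - 10) <= u -> r * (3 * n - 4) <= u ->
    [/\ 14 <= n, 3 * r < 4 * n - 22 & 2 * n + 4 <= 3 * p].
  clear -n7 => hu hr hpq hc hc'.
  have {hc'} h1 : r * (3 * n - 4) < U by apply: leq_ltn_trans hu.
  have {hc hu} h2 : p * (3 * n - 4) + q * (6 * n - 10) < U by apply: leq_ltn_trans hu.
  have n14 : 14 <= n.
    by apply: quadratic_gt => //; apply: leq_ltn_trans h1; rewrite leq_mul2r hr orbT.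
  have [t et] : exists t, n = t + 14 by exists (n - 14); clear -n14; lia.
  have h3 : 3 * r < 4 * n - 22.
    rewrite ltnNge; apply/negP=> h.
    have : (4 * n - 22) * (3 * n - 4) <= 3 * r * (3 * n - 4) by rewrite leq_mul2r h orbT.
    rewrite -mulnA; move: h1; set y := r * _; clearbody y; rewrite et; clear; nia.
  split=> //; rewrite leqNgt; apply/negP=> hp.
  have e2 : r * (3 * n - 4) + q * (3 * n - 6) < U.
    by apply: leq_ltn_trans h2; rewrite -hpq et; clear; nia.
  have h4 : (n - 3) * (3 * n - 4) <= r * (3 * n - 4) by rewrite leq_mul2r hr orbT.
  have h5 : n - 12 <= 3 * q by clear -hp hr hpq n14; lia.
  have h6 : (n - 12) * (3 * n - 6) <= 3 * q * (3 * n - 6) by rewrite leq_mul2r h5 orbT.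
  move: e2 h4 h6; rewrite -mulnA; set y := q * _; set x := r * _; clearbody x y.
  by rewrite et; clear; nia.
have [n14 hr3 hp3] := arith1 _ _ _ _ hrs hR cR cost r1.
have [v0 v0P] : exists v, v \in P by apply/set0Pn; rewrite -card_gt0; arith.
move: (v0P); rewrite in_set => /andP[v0R /existsP[k /eqP dk]].
have Nk := near_mono_avoiding v0R dk.
have [i [j [ij ik jk all3]]] := two_other_colors k.
have hcover := subset_leq_card (trichromatic_cover c all3 setT).
rewrite cardsT card_ord in hcover.
have cover2 : N <= #|R| + (#|avoiding c i :|: avoiding c j| + #|avoiding c k|).
  apply: leq_trans hcover _; apply: leq_trans (leq_card_setU _ _) _; rewrite leq_add2l setUA.
  exact: leq_card_setU.
have cU : #|avoiding c i :|: avoiding c j| = #|avoiding c i| + #|avoiding c j :\: avoiding c i|.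
  by rewrite -(cardsID (avoiding c i) (_ :|: _)) setUK setDUl setDv set0U.
have Ni := hN' i; have Nj := hN' j.
have cDj : #|avoiding c j :\: avoiding c i| <= #|avoiding c j| by apply/subset_leq_card/subsetDl.
have cUji : #|avoiding c i :|: avoiding c j| <= #|avoiding c i| + #|avoiding c j| by apply: leq_card_setU.
(* If [l] were not [k], two classes would have at most 2 vertices each and the third at most n, too
   few to cover all vertices together with [R]. *)
have allk v : v \in P -> d v k = 3 * n - 4.
  rewrite in_set => /andP[vR /existsP[l /eqP dl]].
  have Nl := near_mono_avoiding vR dl.
  case/or3P: (all3 l) => /eqP el; subst l; [exfalso; arith|exfalso; arith|by []].
pose p := minn #|P| n; have p_le : p <= #|P| by apply: geq_minl.
have pn : p <= n by apply: geq_minr.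
have p3 : 2 * n + 4 <= 3 * p by rewrite /p; case: (leqP #|P| n) => ?; arith.
have [P' sP' cP'] := subset_of_size p_le.
(* Edges between [avoiding c i] and [B] have color [k]. So n - p edges join [A0] to [B0], and p
   edges join [P'] to the rest [K] of the two classes. *)
pose B := avoiding c j :\: avoiding c i.
have [A0 sA0 cA0] : exists2 A0 : {set V}, A0 \subset avoiding c i & #|A0| = n - p.
  by apply: subset_of_size; arith.
have [B0 sB0 cB0] : exists2 B0 : {set V}, B0 \subset B & #|B0| = n - p.
  by apply: subset_of_size; rewrite /B; arith.
pose g : rel V := fun x y => col c x y == k.
have gsym : symmetric g by move=> x y; rewrite /g col_sym.
have sB : B \subset avoiding c j by apply: subsetDl.
have dAB : [disjoint avoiding c i & B].
  by rewrite disjoints_subset; apply/subsetP=> x xA; rewrite in_setC in_setD xA.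
have gAB x y : x \in avoiding c i -> y \in B -> g x y.
  move=> xA yB; have xy : x != y by apply: contraTneq yB => <-; rewrite (disjointFr dAB xA).
  have yj := subsetP sB y yB.
  have h1 : col c x y != i by apply: avoidingP xA _; rewrite eq_sym.
  have h2 : col c x y != j by rewrite col_sym; apply: avoidingP yj _.
  by rewrite /g; have := all3 (col c x y); rewrite (negbTE h1) (negbTE h2).
have base : 0 < #|matchings setT g true (A0 :|: B0) (n - p)|.
  apply: leq_trans (_ : (n - p) ^_ (n - p) <= _); first by rewrite ffactnn fact_gt0.
  apply: (matchings_many gsym (H := A0) (K := B0)); rewrite ?subsetUl ?subsetUr ?cA0 //.
  - by apply: disjointWl sA0 _; apply: disjointWr sB0 dAB.
  - move=> h hA; rewrite -cB0; apply: subset_leq_card; apply/subsetP=> x xB.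
    by rewrite in_set xB gAB ?(subsetP sA0) ?(subsetP sB0).
  - by move=> *; rewrite in_setT.
pose K := (avoiding c i :|: B) :\: (A0 :|: B0).
have cA0B0 : #|A0 :|: B0| <= (n - p).*2.
  by apply: leq_trans (leq_card_setU _ _) _; rewrite cA0 cB0 addnn.
have eUB : avoiding c i :|: B = avoiding c i :|: avoiding c j.
  by rewrite /B; apply/setP=> x; rewrite !in_setU in_setD; case: (x \in avoiding c i).
have cK : #|avoiding c i :|: avoiding c j| <= #|K| + (n - p).*2.
  by rewrite /K eUB -(cardsID (A0 :|: B0)) addnC leq_add2l; apply: leq_trans cA0B0; apply/subset_leq_card/subsetIr.
have dPK : [disjoint P' & K].
  rewrite disjoints_subset; apply/subsetP=> v vP; have vR := subsetP sPR v (subsetP sP' v vP).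
  have vU : v \notin avoiding c i :|: avoiding c j.
    by rewrite in_setU negb_or !avoiding_tri.
  by rewrite in_setC /K eUB in_setD (negbTE vU) andbF.
have main : (#|K| - 2) ^_ p <= #|matchings setT g true (P' :|: K) p|.
  apply: (matchings_many gsym (H := P') (K := K)); rewrite ?subsetUl ?subsetUr ?cP' //; last first.
    by move=> *; rewrite in_setT.
  move=> h hP; have hP2 := subsetP sP' h hP; have hR' := subsetP sPR h hP2.
  have dh := allk h hP2; have ds := deg_sum3 ij ik jk all3 h.
  have : #|K| <= #|[set x in K | g h x == true]| + (d h i + d h j).
    apply: leq_trans (leq_add (leqnn _) (leq_card_setU _ _)).
    apply: leq_trans (leq_card_setU _ _); apply: subset_leq_card; apply/subsetP=> x xK.
    have xh : x != h by apply: contraTneq xK => ->; rewrite (disjointFr dPK hP).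
    case/or3P: (all3 (col c h x)) => hc; apply/setUP;
      [right; apply/setUP; left|right; apply/setUP; right|left].
    - by rewrite in_set xh hc.
    - by rewrite in_set xh hc.
    - by rewrite in_set xK /g hc.
  by move=> ?; arith.
have dW : [disjoint P' :|: K & A0 :|: B0].
  rewrite disjoints_subset; apply/subsetP=> x; rewrite in_setU in_setC => /orP[xP|]; last by case/setDP.
  have vR := subsetP sPR x (subsetP sP' x xP).
  rewrite in_setU negb_or; apply/andP; split.
    by apply: contra (avoiding_tri i vR); apply: (subsetP sA0).
  by apply: contra (avoiding_tri j vR) => /(subsetP sB0)/(subsetP sB).
have : (#|K| - 2) ^_ p <= #|matchings setT g true setT n|.
  apply: leq_trans (_ : #|matchings setT g true ((P' :|: K) :|: (A0 :|: B0)) (p + (n - p))| <= _).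
    apply: leq_trans (matchings_prod setT g true p (n - p) dW).
    by rewrite -[leqLHS]muln1; apply: leq_mul.
  by rewrite subnKC //; apply/subset_leq_card/matchings_mono/subsetT.
have : #|matchings setT g true setT n| <= monos.
  rewrite -(card_imset _ (_ : injective (fun M => (cover M, M)))); last by move=> M M' [].
  apply: subset_leq_card; apply/subsetP=> _ /imsetP[M hM ->].
  apply: (mono_copy_matchings hM (i := k)) => e /existsP[x /existsP[y /and4P[_ _ gxy /eqP->]]].
  by move: gxy; rewrite /g eqb_id => /eqP.
(* Outside [R] and the at most two vertices avoiding [k] there are at least 3n - 3 - r vertices, r
   being the size of [R]; [A0] and [B0] take 2(n - p) of them. *)
have hK : n + 5 <= #|K| - 2 by arith.
have : (n + 5) ^_ 3 <= (#|K| - 2) ^_ p.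
  apply: leq_trans (leq_ffact 3 hK) _; apply: leq_ffactr; first by arith.
  by apply: leq_trans pn _; apply: leq_trans hK; rewrite leq_addr.
rewrite ffact3 => h1 h2 h3; apply: leq_trans (leq_trans h1 (leq_trans h3 h2)).
have [t et] : exists t, n = t + 14 by exists (n - 14); arith.
by rewrite et; clear; nia.
Qed.

End Main.

(** Let r be the number of trichromatic vertices. If all classes had at most n - 1 vertices,
    covering 3n - 1 vertices would force r >= 2 and at least n + 1 - r vertices in each class. By
    [avoiding_deg] any two color degrees of a trichromatic vertex then have at least this sum, and
    [star_cost_pairs] gives too many stars. *)
Lemma large_avoiding n N (c : coloring 3 N) : 7 <= n -> N.+1 = 3 * n ->
  #|rainbow_copies c star3| < (n - 6) * (4 * n - 5) + n + 1 ->
  #|trichromatic c| + 4 <= n -> exists k, n <= #|avoiding c k|.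
Proof.
move=> n7 hN hrs hR; apply/existsP; apply: contraT; rewrite negb_exists => /forallP hk.
have [i [j [ij ik jk all3]]] := two_other_colors ord0; set k : 'I_3 := ord0 in ik jk all3.
have hN' l : #|avoiding c l| <= n - 1 by have := hk l; rewrite -ltnNge => ?; arith.
have : N <= #|trichromatic c| + (#|avoiding c i| + (#|avoiding c j| + #|avoiding c k|)).
  have := subset_leq_card (trichromatic_cover c all3 setT); rewrite cardsT card_ord => h.
  apply: leq_trans h _; apply: leq_trans (leq_card_setU _ _) _; rewrite leq_add2l.
  apply: leq_trans (leq_card_setU _ _) _; rewrite leq_add2l.
  exact: leq_card_setU.
move=> hcover; have hi := hN' i; have hj := hN' j; have hk' := hN' k.
have r2 : 2 <= #|trichromatic c| by arith.
have hlow l : n + 1 - #|trichromatic c| <= #|avoiding c l|.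
  by case/or3P: (all3 l) => /eqP->; arith.
have cost : #|trichromatic c| * ((n - #|trichromatic c|) * (2 * n - 1)) <= #|rainbow_copies c star3|.
  rewrite -sum_nat_const; apply: (cost_sum ij ik jk all3) => v vR.
  have pair l : n + 1 - #|trichromatic c| <= \sum_(l' | l' != l) #|color_nbr c v l'|.
    have [i' [j' [ij' ik' jk' all3']]] := two_other_colors l.
    apply: leq_trans (hlow l) _; apply: leq_trans (avoiding_deg all3' (avoiding_tri l vR)) _.
    rewrite (bigD1 i') //= (bigD1 j') /=; last by rewrite jk' eq_sym.
    by rewrite addnA leq_addr.
  have split3 l : \sum_l' #|color_nbr c v l'| = #|color_nbr c v l| + \sum_(l' | l' != l) #|color_nbr c v l'|.
    by rewrite (bigD1 l).
  have tot : \sum_l' #|color_nbr c v l'| = #|color_nbr c v i| + (#|color_nbr c v j| + #|color_nbr c v k|).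
    by rewrite (big3 ij ik jk all3).
  have pi := pair i; have pj := pair j; have pk := pair k.
  have si := split3 i; have sj := split3 j; have sk := split3 k.
  have p l : 0 < #|color_nbr c v l| by apply: tri_pos.
  have h := star_cost_pairs (p i) (p j) (p k) (deg_sum3 c n7 hN ij ik jk all3 v) r2 hR.
  by apply: h; arith.
have [t et] : exists t, n = #|trichromatic c| + 4 + t by exists (n - #|trichromatic c| - 4); arith.
have [s es] : exists s, #|trichromatic c| = s + 2 by exists (#|trichromatic c| - 2); arith.
move: cost hrs; rewrite -ltnS => h1 h2; have := leq_trans h1 h2; rewrite es.
have en : n = s + t + 6 by arith.
have -> : n - (s + 2) = t + 4 by arith.
have -> : n - 6 = s + t by arith.
have -> : 2 * n - 1 = 2 * s + 2 * t + 11 by arith.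
have -> : 4 * n - 5 = 4 * s + 4 * t + 19 by arith.
by rewrite en; clear; nia.
Qed.

(** With few trichromatic vertices some class has n vertices and the count applies with d = 0. With
    many, it applies with d = 1 if a class has n + 1 vertices; otherwise the nearly monochromatic
    vertices decide. *)
Lemma GM_lower_large n N (c : coloring 3 N) : 7 <= n -> N.+1 = 3 * n ->
  lower_bound n <= #|rainbow_copies c star3| + #|mono_copies c (matching n)|.
Proof.
move=> n7 hN; apply: leq_trans (lower_bound_quadratic (ltnW n7)) _.
set U := (X in X <= _); case: (leqP U #|rainbow_copies c star3|) => hrs.
  by apply: leq_trans hrs _; apply: leq_addr.
apply: leq_trans (leq_addl _ _).
case: (leqP (#|trichromatic c| + 4) n) => hR.
  have [k hk] := large_avoiding n7 hN hrs hR.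
  have [i [j [ij ik jk all3]]] := two_other_colors k.
  have := @engine_main n N c n7 hN i j k ij ik jk all3 0 isT hrs.
  rewrite orFb addn0 => /(_ _ hk) h; apply: leq_trans (h _); last by arith.
  by rewrite subn0; apply: quadratic_leq_ffact2.
have hR' : n - 3 <= #|trichromatic c| by arith.
have [/existsP[k hk]|] := boolP [exists k, n + 1 <= #|avoiding c k|]; last first.
  rewrite negb_exists => /forallP hk; apply: near_mono_main hrs hR' _ => // l.
  by have := hk l; rewrite -ltnNge => ?; arith.
have [i [j [ij ik jk all3]]] := two_other_colors k.
have := @engine_main n N c n7 hN i j k ij ik jk all3 1 isT hrs isT hk; apply: leq_trans.
have h1 := tri_cost c n7 hN ij ik jk all3.
have -> : n - 1 - 2 = n - 3 by arith.
apply: quadratic_leq_ffact3; apply: quadratic_gt => //; apply: leq_ltn_trans hrs.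
by apply: leq_trans h1; rewrite leq_mul2r hR' orbT.
Qed.

(** For n at most 6 the stars at a single trichromatic vertex suffice, and if there is none,
    [mono_pure] does. *)
Lemma GM_lower n N (c : coloring 3 N) : 2 <= n -> N.+1 = 3 * n ->
  lower_bound n <= #|rainbow_copies c star3| + #|mono_copies c (matching n)|.
Proof.
move=> n2 hN; case: (leqP 7 n) => n7; first exact: GM_lower_large.
have n26 : 2 <= n <= 6 by rewrite n2 -ltnS.
have [R0|/set0Pn[v vR]] := eqVneq (trichromatic c) set0.
  apply: leq_trans (leq_addl _ _); apply: leq_trans (lower_bound_small n26) _.
  by apply: (@mono_pure N c n setT) => //; rewrite cardsT card_ord.
apply: leq_trans (leq_addr _ _); apply: leq_trans (lower_bound_small_star n26) _.
have [i [j [ij ik jk all3]]] := two_other_colors ord0.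
apply: leq_trans (cost_triple c ij ik jk all3).
rewrite (bigD1 v) //=; apply: leq_trans (leq_addr _ _).
have pos l : 0 < #|color_nbr c v l| by move: vR; rewrite inE => /forallP/(_ l); rewrite card_gt0.
apply: star_cost; rewrite ?pos // (color_nbr_sum c ij ik jk all3).
by arith.
Qed.

Lemma gr_upper n : 2 <= n -> gr_bound 3 star3 (matching n) (3 * n - 1).
Proof.
move=> n2; split.
  apply: (@leq_trans 'C(5, 2)) => //; apply: leq_bin2l; arith.
move=> N hN c _.
have [R0|/set0Pn[v vR]] := eqVneq (trichromatic c) set0; last first.
  left; have h l : exists x, x \in color_nbr c v l.
    by move: vR; rewrite inE => /forallP/(_ l)/set0Pn.
  have [x hx] := h (inord 0); have [y hy] := h (inord 1); have [z hz] := h (inord 2).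
  by exists (star v x y z); apply: star_rainbow.
right; have [W _ cW] : exists2 W : {set complete N}, W \subset setT & #|W| = 3 * n - 1.
  by apply: subset_of_size; rewrite cardsT card_ord.
apply/set0Pn; rewrite -card_gt0; apply: leq_trans (mono_pure n2 _ R0 (W := W)).
  by rewrite ffact_gt0; arith.
by rewrite cW; arith.
Qed.

Theorem theorem3p7 (n : nat) (hn : 2 <= n) :
  exists2 g, is_GM 3 star3 (matching n) g &
    lower_bound n <= g <= odd_double_fact n.
Proof.
pose N := 3 * n - 1.
have hN : N.+1 = 3 * n by rewrite /N; arith.
have hgr : is_gr 3 star3 (matching n) N.
  by split; [exact: gr_upper|move=> m; apply: gr_lower].
pose total (c : coloring 3 N) := #|rainbow_copies c star3| + #|mono_copies c (matching n)|.
pose exactb (c : coloring 3 N) := [forall i, [exists e in edges (complete N), c e == i]].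
have exactP (c : coloring 3 N) : reflect (exact c) (exactb c).
  apply: (iffP forallP) => [h i|h i].
    by have /exists_inP[e eE /eqP ce] := h i; exists e.
  by have [e eE <-] := h i; apply/exists_inP; exists e.
have [c0 ec0 hc0] := GM_upper hn.
pose cm := [arg min_(c < c0 | exactb c) total c].
have [ecm hcm] : exactb cm /\ forall c, exactb c -> total cm <= total c.
  by rewrite /cm; case: arg_minnP => //; apply/exactP.
exists (total cm); last first.
  by rewrite GM_lower //= (leq_trans (hcm c0 _) hc0) //; apply/exactP.
exists N => //; split; first by exists cm => //; apply/exactP.
by move=> m [c /exactP ec ->]; apply: hcm.
Qed.
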